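(* Let $T>0$ and suppose the impulsive generalized Riccati equation (I-GRE) has a solution $P^*$. Then $$J_T^\star(X_1^0)=\max_{P\ \text{piecewise-}C^1}\ \langle P(t_0),X_1^0\rangle$$ subject to $$P\succeq0,\quad \mathcal C_Z(t,P(t))\succeq0,\quad \mathcal D_Z(k,P(t_k^+),P(t_k^-))\succeq0,\quad P(t_0+T)\preceq Z_T$$ (the flow constraint for a.e. $t\in[t_0,t_0+T]$ between jumps, the jump constraint for $k=1,\dots,N_T$), and the maximum is attained at $P^*$.
   Context: Notation. Fix integers $n,m\ge1$. $\mathbb H^p$, $\mathbb H^p_{\succeq0}$: $p\times p$ complex Hermitian, resp. positive semidefinite, matrices; $\langle A,B\rangle=\operatorname{trace}(AB^* )$; $A^\dagger$ is the Moore–Penrose pseudoinverse. $E=[I_n\ \ 0]\in\mathbb C^{n\times(n+m)}$. System. Jump times $t_1<t_2<\cdots$, $t_k\to\infty$; dynamics $$E\dot X(t)E^*=\mathcal F(t,X(t))\ (t\ne t_k),\quad EX(t_k^+)E^*=\mathcal J(k,X(t_k^-)),\quad EX(t_0)E^*=X_1^0\in\mathbb H^n_{\succeq0}.$$ $\mathcal F(t,\cdot),\mathcal J(k,\cdot):\mathbb H^{n+m}\to\mathbb H^n$ are linear and bounded, $\mathcal F$ is continuous in $t$, both leave the positive semidefinite cone invariant (the state block stays positive semidefinite); adjoints: $\langle P,\mathcal F(t,X)\rangle=\langle\mathcal F^*(t,P),X\rangle$, $\langle P,\mathcal J(k,X)\rangle=\langle\mathcal J^*(k,P),X\rangle$.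 A trajectory is an $\mathbb H^{n+m}_{\succeq0}$-valued function satisfying these equations (regular enough that the limits and integrals involved make sense); the blocks of $X$ other than $EXE^*$ are free decision variables. Cost. $\{t_k\}_{k=1}^{N_T}$ are the jump times in $(t_0,t_0+T)$; $Z(t)\succeq0$ and $Z_k\succeq0$ in $\mathbb H^{n+m}$, $Z_T\in\mathbb H^n_{\succeq0}$; $$J_T(X,X_1^0)=\int_{t_0}^{t_0+T}\langle Z(t),X(t)\rangle dt+\sum_{k=1}^{N_T}\langle Z_k,X(t_k^-)\rangle+\langle Z_T,EX(t_0+T)E^*\rangle,$$ and $J_T^\star(X_1^0)$ is the infimum of $J_T$ over trajectories. I-GRE. Let $\mathcal C_Z(t,P(t))=E^*\dot P(t)E+\mathcal F^*(t,P(t))+Z(t)$, $\mathcal D_Z(k,P(t_k^+),P(t_k^-))=\mathcal J^*(k,P(t_k^+))-E^*P(t_k^-)E+Z_k$. Any $\mathcal L\in\mathbb H^{n+m}$ is partitioned as $\begin{bmatrix}\mathcal L_1&\mathcal L_2\\\mathcal L_2^*&\mathcal L_3\end{bmatrix}$ with $\mathcal L_1\in\mathbb H^n$, $\mathcal L_3\in\mathbb H^m$. A piecewise-$C^1$ $P:[t_0,t_0+T]\to\mathbb H^n$ (continuous and piecewise $C^1$ between consecutive jump times, one-sided limits at jump times, possibly discontinuous there) solves the I-GRE if both $\mathcal L=\mathcal C_Z(t,P(t))$ (for a.e. $t$ between jumps) and $\mathcal L=\mathcal D_Z(k,P(t_k^+),P(t_k^-))$ (for $k=1,\dots,N_T$)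 satisfy $$\mathcal L_1-\mathcal L_2\mathcal L_3^\dagger\mathcal L_2^*=0,\qquad \mathcal L_3\mathcal L_3^\dagger\mathcal L_2^*=\mathcal L_2^*,\qquad \mathcal L_3\succeq0,$$ together with the terminal condition $P(t_0+T)=Z_T$.
   Formalization: Adds that the feedback gain −L₃†L₂* of L = C_Z(t,P*(t)) is measurable and square integrable on [t₀,t₀+T]; without it an I-GRE solution need not be optimal. Z is taken integrable on the horizon. *)

(* Defs.v *)
From mathcomp Require Import all_boot all_order all_algebra.
From mathcomp Require Import sesquilinear spectral.
From mathcomp Require Import all_classical all_reals all_analysis.
From mathcomp Require Import complex.

Set Implicit Arguments.
Unset Strict Implicit.
Unset Printing Implicit Defensive.

Import Order.TTheory GRing.Theory Num.Theory.
Import numFieldNormedType.Exports.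

Local Open Scope classical_set_scope.
Local Open Scope ring_scope.
Local Open Scope complex_scope.
Local Open Scope sesquilinear_scope.

Section MatrixNotions.
Context {R : realType}.

Definition herm p (A : 'M[R[i]]_p) : Prop := A \is hermsymmx.

Definition psd p (A : 'M[R[i]]_p) : Prop :=
  herm A /\ forall v : 'rV[R[i]]_p, 0 <= (v *m A *m v^t*) 0 0.

(* The trace of A *m B^t* is real when A and B are Hermitian, which is the
   only case of interest below, so taking the real part loses nothing. *)
Definition inner p (A B : 'M[R[i]]_p) : R := complex.Re (\tr (A *m B^t*)).

Definition is_mpinv p q (A : 'M[R[i]]_(p, q)) (B : 'M[R[i]]_(q, p)) : Prop :=
  [/\ A *m B *m A = A, B *m A *m B = B,
      (A *m B)^t* = A *m B & (B *m A)^t* = B *m A].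

(* The matrix satisfying the four Penrose conditions. *)
Definition mpinv p q (A : 'M[R[i]]_(p, q)) : 'M[R[i]]_(q, p) :=
  xget 0 [set B | is_mpinv A B].

(* E = [I_n 0] *)
Definition Emx n m : 'M[R[i]]_(n, n + m) := row_mx 1%:M 0.

(* Real-linear maps between spaces of Hermitian matrices are represented by
   functions on all matrices, only whose values at Hermitian ones matter.
   Boundedness is automatic in finite dimension. *)
Definition herm_linear p q (f : 'M[R[i]]_p -> 'M[R[i]]_q) : Prop :=
  (forall A, herm A -> herm (f A)) /\
  (forall (a : R) A B, herm A -> herm B ->
     f (a%:C *: A + B) = a%:C *: f A + f B).

Definition herm_adjoint p q (f : 'M[R[i]]_p -> 'M[R[i]]_q)
    (g : 'M[R[i]]_q -> 'M[R[i]]_p) : Prop :=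
  (forall P, herm P -> herm (g P)) /\
  (forall P A, herm P -> herm A -> inner P (f A) = inner (g P) A).

End MatrixNotions.

(* Analysis of functions R -> 'M[R[i]]_(p, q) is done on the real and imaginary
   parts of the entries. *)
Section MatrixAnalysis.
Context {R : realType}.
Implicit Types (p q : nat) (D : set R).
Local Notation mu := (@lebesgue_measure R).

Definition mx_all (Q : (R -> R) -> Prop) p q (A : R -> 'M[R[i]]_(p, q)) : Prop :=
  forall i j, Q (fun t => complex.Re (A t i j)) /\
              Q (fun t => complex.Im (A t i j)).

Definition mx_op (op : (R -> R) -> R) p q (A : R -> 'M[R[i]]_(p, q)) :
    'M[R[i]]_(p, q) :=
  \matrix_(i, j) (op (fun t => complex.Re (A t i j)) +i*
                  op (fun t => complex.Im (A t i j))).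

Definition mx_cvg (G : set_system R) p q (A : R -> 'M[R[i]]_(p, q))
    (B : 'M[R[i]]_(p, q)) : Prop :=
  forall i j, complex.Re (A t i j) @[t --> G] --> complex.Re (B i j) /\
              complex.Im (A t i j) @[t --> G] --> complex.Im (B i j).

Definition left_lim p q (A : R -> 'M[R[i]]_(p, q)) (t : R) : 'M[R[i]]_(p, q) :=
  mx_op (fun f => lim (f @ t^'-)) A.

Definition right_lim p q (A : R -> 'M[R[i]]_(p, q)) (t : R) : 'M[R[i]]_(p, q) :=
  mx_op (fun f => lim (f @ t^'+)) A.

Definition mx_deriv p q (A : R -> 'M[R[i]]_(p, q)) (t : R) : 'M[R[i]]_(p, q) :=
  mx_op (fun f => derive1 f t) A.

Definition mx_int (a b : R) p q (A : R -> 'M[R[i]]_(p, q)) : 'M[R[i]]_(p, q) :=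
  mx_op (fun f => Rintegral mu `[a, b] f) A.

Definition mx_measurable D p q (A : R -> 'M[R[i]]_(p, q)) : Prop :=
  mx_all (fun f => measurable_fun D f) A.

Definition mx_integrable D p q (A : R -> 'M[R[i]]_(p, q)) : Prop :=
  mx_all (fun f => mu.-integrable D (EFin \o f)) A.

Definition mx_sq_integrable D p q (A : R -> 'M[R[i]]_(p, q)) : Prop :=
  mx_measurable D A /\
  mx_all (fun f => mu.-integrable D (fun t => (f t ^+ 2)%:E)) A.

Definition mx_C1 p q (A : R -> 'M[R[i]]_(p, q)) : Prop :=
  mx_all (fun f => (forall t, derivable f t 1) /\ continuous (derive1 f)) A.

End MatrixAnalysis.

Section PsdInvariance.
Context {R : realType} (n m : nat).

(* Every positive semidefinite X with E X E^* = Y has this form, for some K and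
   some positive semidefinite W; for Y that is positive semidefinite, so is it. *)
Definition completion (Y : 'M[R[i]]_n) (K : 'M[R[i]]_(m, n)) (W : 'M[R[i]]_m) :
    'M[R[i]]_(n + m) :=
  block_mx Y (Y *m K^t*) (K *m Y) (K *m Y *m K^t* + W).

(* The state block stays positive semidefinite along the flow of F, whatever
   the free blocks.  The free blocks are parametrized by a gain K and a matrix W
   because the state is not known beforehand to be positive semidefinite.
   K is square integrable and W integrable, so that the equation is linear in Y
   with integrable coefficients and its solution is unique. *)
Definition flow_preserves_psd (t0 : R)
    (F : R -> 'M[R[i]]_(n + m) -> 'M[R[i]]_n) : Prop :=
  forall (a b : R) (Y : R -> 'M[R[i]]_n) (K : R -> 'M[R[i]]_(m, n))
         (W : R -> 'M[R[i]]_m),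
    let FX := fun t => F t (completion (Y t) (K t) (W t)) in
    t0 <= a -> a <= b ->
    mx_sq_integrable `[a, b] K ->
    mx_integrable `[a, b] W ->
    (forall t, a <= t <= b -> psd (W t)) ->
    (forall t, a <= t <= b -> herm (Y t)) ->
    mx_integrable `[a, b] FX ->
    (forall t, a <= t <= b -> Y t = Y a + mx_int a t FX) ->
    psd (Y a) ->
    forall t, a <= t <= b -> psd (Y t).

End PsdInvariance.

(* Jumps are numbered from 0: jump_time S k, J k, Jadj k and Zj k stand for
   t_(k+1), J(k+1, .), J^*(k+1, .) and Z_(k+1). *)
Record impulsive_system (R : realType) (n m : nat) := ImpulsiveSystem {
  t0 : R;
  jump_time : nat -> R;
  F : R -> 'M[R[i]]_(n + m) -> 'M[R[i]]_n;
  Fadj : R -> 'M[R[i]]_n -> 'M[R[i]]_(n + m);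
  J : nat -> 'M[R[i]]_(n + m) -> 'M[R[i]]_n;
  Jadj : nat -> 'M[R[i]]_n -> 'M[R[i]]_(n + m);
  t0_lt_jump_time : t0 < jump_time 0;
  jump_time_incr : forall k, jump_time k < jump_time k.+1;
  jump_time_unbounded : jump_time k @[k --> \oo] --> +oo;
  F_linear : forall t, t0 <= t -> herm_linear (F t);
  F_continuous : forall A, herm A -> forall t, t0 <= t ->
    mx_cvg (within [set s | t0 <= s] (nbhs t)) (F^~ A) (F t A);
  F_adjoint : forall t, t0 <= t -> herm_adjoint (F t) (Fadj t);
  F_psd : flow_preserves_psd t0 F;
  J_linear : forall k, herm_linear (J k);
  J_adjoint : forall k, herm_adjoint (J k) (Jadj k);
  J_psd : forall k A, psd A -> psd (J k A)
}.

(* Cost data on the horizon [t0, t0 + T]; NT is the number of jump times in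
   ]t0, t0 + T[. *)
Record horizon_cost (R : realType) (n m : nat) (S : impulsive_system R n m)
    (T : R) := HorizonCost {
  NT : nat;
  Z : R -> 'M[R[i]]_(n + m);
  Zj : nat -> 'M[R[i]]_(n + m);
  ZT : 'M[R[i]]_n;
  NTP : forall k, (k < NT)%N = (jump_time S k < t0 S + T);
  Z_psd : forall t, t0 S <= t <= t0 S + T -> psd (Z t);
  Z_integrable : mx_integrable `[t0 S, t0 S + T] Z;
  Zj_psd : forall k, (k < NT)%N -> psd (Zj k);
  ZT_psd : psd ZT
}.

Section Problem.
Context {R : realType} {n m : nat} (S : impulsive_system R n m) (T : R)
  (C : horizon_cost S T).
Implicit Types (X : R -> 'M[R[i]]_(n + m)) (P : R -> 'M[R[i]]_n).
Local Notation mu := (@lebesgue_measure R).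
Local Notation E := (@Emx R n m).
Local Notation t0 := (t0 S).
Local Notation t1 := (t0 + T).
Local Notation tj := (jump_time S).

Definition state_block X (t : R) : 'M[R[i]]_n := E *m X t *m E^t*.

(* Between jumps, the differential equation is meant in the sense of
   Caratheodory: the state block is absolutely continuous and satisfies it
   almost everywhere. *)
Record trajectory (X10 : 'M[R[i]]_n) X : Prop := Trajectory {
  traj_psd : forall t, t0 <= t <= t1 -> psd (X t);
  traj_measurable : mx_measurable `[t0, t1] X;
  traj_integrable : mx_integrable `[t0, t1] (fun t => F S t (X t));
  traj_flow : forall a b, t0 <= a -> a <= b -> b <= t1 ->
    (forall k, (k < NT C)%N -> ~ (a <= tj k <= b)) ->
    state_block X b = state_block X a + mx_int a b (fun t => F S t (X t));
  traj_left_lim : forall k, (k < NT C)%N ->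
    mx_cvg (tj k)^'- X (left_lim X (tj k));
  traj_jump : forall k, (k < NT C)%N ->
    mx_cvg (tj k)^'+ (state_block X) (J S k (left_lim X (tj k)));
  traj_init : state_block X t0 = X10
}.

Definition cost X : \bar R :=
  (\int[mu]_(t in `[t0, t1]) (inner (Z C t) (X t))%:E
   + (\sum_(k < NT C) inner (Zj C k) (left_lim X (tj k))
      + inner (ZT C) (state_block X t1))%:E)%E.

Definition optimal_cost (X10 : 'M[R[i]]_n) : \bar R :=
  ereal_inf [set cost X | X in trajectory X10].

(* On each of the finitely many closed pieces, P agrees in the interior with a
   function that is C^1 on the whole line (equivalently, C^1 up to the
   boundary); P is continuous away from jump times.  Its values at jump times
   are immaterial. *)
Record piecewise_C1 P : Prop := PiecewiseC1 {
  pwC1_herm : forall t, t0 <= t <= t1 -> herm (P t);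
  pwC1_pieces : exists s : seq R, forall a b, t0 <= a -> a < b -> b <= t1 ->
    (forall r, r \in s -> ~ (a < r < b)) ->
    exists2 Q : R -> 'M[R[i]]_n, mx_C1 Q & forall t, a < t < b -> P t = Q t;
  pwC1_continuous : forall t, t0 <= t <= t1 ->
    (forall k, (k < NT C)%N -> t <> tj k) ->
    mx_cvg (within `[t0, t1] (nbhs t)) P (P t)
}.

Definition CZ P (t : R) : 'M[R[i]]_(n + m) :=
  E^t* *m mx_deriv P t *m E + Fadj S t (P t) + Z C t.

Definition DZ P (k : nat) : 'M[R[i]]_(n + m) :=
  Jadj S k (right_lim P (tj k)) - E^t* *m left_lim P (tj k) *m E + Zj C k.

Definition GRE (L : 'M[R[i]]_(n + m)) : Prop :=
  let L1 := ulsubmx L in let L2 := ursubmx L in let L3 := drsubmx L in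
  [/\ L1 - L2 *m mpinv L3 *m L2^t* = 0, L3 *m mpinv L3 *m L2^t* = L2^t*
    & psd L3].

Record IGRE_solution P : Prop := IGRESolution {
  igre_pwC1 : piecewise_C1 P;
  igre_flow : {ae mu, forall t, `[t0, t1]%classic t -> GRE (CZ P t)};
  igre_jump : forall k, (k < NT C)%N -> GRE (DZ P k);
  igre_final : P t1 = ZT C
}.

(* The gain of the minimizing feedback associated with P.  Its square
   integrability is what makes the closed loop well posed; a solution of the
   Riccati equation need not have it, and need not be optimal then: for
   n = m = 1, F(t, X) = 2 Re X_12, Z(t) = [1 t; t t^2] on [-1, 0], Z_T = 0 and
   no jumps, P = 0 (with gain -1/t) and P(t) = -t (with gain 0) are both
   solutions. *)
Definition feedback_gain P (t : R) : 'M[R[i]]_(m, n) :=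
  - (mpinv (drsubmx (CZ P t)) *m (ursubmx (CZ P t))^t*).

Record dual_feasible P : Prop := DualFeasible {
  dual_pwC1 : piecewise_C1 P;
  dual_psd : forall t, t0 <= t <= t1 ->
    (forall k, (k < NT C)%N -> t <> tj k) -> psd (P t);
  dual_flow : {ae mu, forall t, `[t0, t1]%classic t -> psd (CZ P t)};
  dual_jump : forall k, (k < NT C)%N -> psd (DZ P k);
  dual_final : psd (ZT C - P t1)
}.

End Problem.

(* Main.v *)
Require Import Defs.
From mathcomp Require Import all_boot all_order all_algebra.
From mathcomp Require Import sesquilinear spectral.
From mathcomp Require Import all_classical all_reals all_analysis.
From mathcomp Require Import measurable_realfun.
From mathcomp Require Import complex ring lra.

(** Let P be piecewise C1 and X a trajectory. On a piece between jumps the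
pairing <P, E X E^*> is absolutely continuous with derivative
<C_Z(t, P) - Z, X>, since the adjoint moves F from X to P. At a jump time the
pairing changes by <D_Z(k, P) - Z_k, X(t_k^-)>. Adding up the pieces and the
jumps gives an exact identity, [energy_total]:

  cost X = <P(t0), X10> + integral of <C_Z(t, P), X>
           + sum over k of <D_Z(k, P), X(t_k^-)> + <Z_T - P(t1), E X(t1) E^*>.

Weak duality. If P is dual feasible, each remainder pairs two positive
semidefinite matrices, so it is nonnegative ([inner_psd_ge0]) and
<P(t0), X10> is a lower bound for every cost ([weak_duality]).

Near-optimal trajectories. If L satisfies the Riccati conditions, then
K = - L3^+ L2^* gives L [I; K] = 0 ([GRE_gain]), and L is positive semidefinite
by completing the square ([GRE_psd]). Hence for a solution P of the Riccati
equation the terminal remainder is zero, the jump remainder at t_k vanishes if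
X(t_k^-) = [I; K] Y [I; K]^* for the gain K of D_Z(k, P), and the flow remainder
vanishes under the feedback gain of C_Z(t, P). These two demands can conflict:
the feedback gain, which is only square integrable, need not have a left limit
at t_k, and such a limit need not be the gain of the jump. The feedback is
therefore replaced by the constant gain of the jump on a short window before
t_k. The closed-loop state is bounded by a constant that does not depend on the
window ([closed_loop]), so the flow remainder over the window is as small as
desired ([near_optimal_piece]). Gluing the pieces gives trajectories of cost at
most <P(t0), X10> + e for every e > 0 ([near_optimal_trajectory]); the infimum
is approached and need not be attained.

Positivity of the solution. A Riccati solution satisfies the flow, jump and
terminal constraints, and it remains to see that P is positive semidefinite.
This propagates backwards from P(t1) = Z_T: on a piece that starts at c from an
arbitrary state Y0, the identity for a near-optimal trajectory bounds
<P(c^+), Y0> below by - e ([IGRE_right_psd]), and at a jump the vanishing of the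
remainder expresses <P(t_k^-), Y> as a sum of nonnegative terms
([IGRE_left_psd]).

The closed loop is a linear equation whose coefficients are merely integrable.
It is solved by the Picard series ([linear_ode]), and the energy identity rests
on a product rule for absolutely continuous functions ([primitiveM]). *)
Set Implicit Arguments.
Unset Strict Implicit.
Unset Printing Implicit Defensive.

Import Order.TTheory GRing.Theory Num.Theory.
Import numFieldNormedType.Exports.
Local Open Scope classical_set_scope.
Local Open Scope ring_scope.
Local Open Scope complex_scope.
Local Open Scope sesquilinear_scope.

(** * Integrals over segments *)
Section SegmentIntegral.
Context {R : realType}.
Local Notation mu := (@lebesgue_measure R).
Implicit Types (a b c d : R) (f g h : R -> R).

Definition L1 a b f : Prop := mu.-integrable `[a, b] (EFin \o f).
Definition integ a b f : R := Rintegral mu `[a, b] f.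

Let mseg a b : measurable (`[a, b]%classic : set (measurableTypeR R)).
Proof. exact: measurable_itv. Qed.

Lemma L1_sub a b c d f : a <= c -> d <= b -> L1 a b f -> L1 c d f.
Proof.
move=> ac db; apply: integrableS => //.
by apply: subset_itvScc => /=; rewrite bnd_simp.
Qed.

Lemma L1_eq a b f g : (forall t, a <= t <= b -> f t = g t) -> L1 a b f -> L1 a b g.
Proof.
move=> fg; apply: eq_integrable => // t; rewrite inE/= in_itv/= => tab.
by rewrite fg.
Qed.

Lemma integ_eq a b f g : (forall t, a <= t <= b -> f t = g t) -> integ a b f = integ a b g.
Proof.
by move=> fg; apply: eq_Rintegral => t; rewrite inE/= in_itv/= => /fg.
Qed.

Lemma L1_measurable a b f : L1 a b f -> measurable_fun `[a, b] f.
Proof. by move=> /measurable_int /measurable_EFinP. Qed.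

Lemma L1D a b f g : L1 a b f -> L1 a b g -> L1 a b (fun t => f t + g t).
Proof.
move=> f1 g1; have := integrableD (mseg a b) f1 g1.
by apply: eq_integrable => // t _ /=; rewrite EFinD.
Qed.

Lemma L1B a b f g : L1 a b f -> L1 a b g -> L1 a b (fun t => f t - g t).
Proof.
move=> f1 g1; have := integrableB (mseg a b) f1 g1.
by apply: eq_integrable => // t _ /=; rewrite EFinB.
Qed.

Lemma L1Z a b r f : L1 a b f -> L1 a b (fun t => r * f t).
Proof.
move=> f1; have := @integrableZl _ _ _ mu _ (mseg a b) r _ f1.
by apply: eq_integrable => // t _ /=; rewrite EFinM.
Qed.

Lemma L1_cst a b r : L1 a b (cst r).
Proof.
apply: measurable_bounded_integrable => //.
  have := @lebesgue_measure_itv R `[a, b]; rewrite /= => ->.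
  by case: ifP => // _; rewrite -EFinB ltry.
by exists `|r|; split => [|M rM t _ /=]; [exact: num_real|exact: ltW].
Qed.

Lemma L1_sum a b (I : finType) (f : I -> R -> R) :
  (forall i, L1 a b (f i)) -> L1 a b (fun t => \sum_i f i t).
Proof.
move=> fi; have := @integrable_sum _ _ _ mu _ (mseg a b) I
  (index_enum I) xpredT (fun i => EFin \o f i) (fun i _ => fi i).
by apply: eq_integrable => // t _ /=; rewrite sumEFin.
Qed.

Lemma L1_norm a b f : L1 a b f -> L1 a b (fun t => `|f t|).
Proof. exact: integrable_norm. Qed.

Lemma L1_le a b f g : measurable_fun `[a, b] f ->
  (forall t, a <= t <= b -> `|f t| <= g t) -> L1 a b g -> L1 a b f.
Proof.
move=> mf fg; apply: le_integrable => //; first exact/measurable_EFinP.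
move=> t /=; rewrite in_itv/= => /fg tfg; rewrite lee_fin.
by rewrite (le_trans tfg)// ler_norm.
Qed.

Lemma L1M_bounded a b f g M : measurable_fun `[a, b] f ->
  (forall t, a <= t <= b -> `|f t| <= M) -> L1 a b g ->
  L1 a b (fun t => f t * g t).
Proof.
move=> mf fM g1; apply: (@L1_le _ _ _ (fun t => M * `|g t|)).
- by apply: measurable_funM => //; exact: L1_measurable.
- by move=> t tab; rewrite normrM ler_wpM2r// fM.
- exact/L1Z/L1_norm.
Qed.

Lemma integD a b f g : L1 a b f -> L1 a b g ->
  integ a b (fun t => f t + g t) = integ a b f + integ a b g.
Proof. by move=> *; apply: RintegralD. Qed.

Lemma integB a b f g : L1 a b f -> L1 a b g ->
  integ a b (fun t => f t - g t) = integ a b f - integ a b g.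
Proof. by move=> *; apply: RintegralB. Qed.

Lemma integZ a b r f : L1 a b f -> integ a b (fun t => r * f t) = r * integ a b f.
Proof. by move=> *; apply: RintegralZl. Qed.

Lemma integ_sum a b (I : finType) (f : I -> R -> R) : (forall i, L1 a b (f i)) ->
  integ a b (fun t => \sum_i f i t) = \sum_i integ a b (f i).
Proof.
move=> fi; rewrite /integ /Rintegral.
under eq_integral do rewrite -sumEFin.
have := @integral_sum _ _ _ mu _ (mseg a b) I
  (fun i t => (f i t)%:E) fi (index_enum I) xpredT.
move=> ->.
have -> : \sum_i fine (\int[mu]_(x in `[a, b]) (f i x)%:E)%E =
    fine (\sum_i (integ a b (f i))%:E)%E by rewrite sumEFin.
congr fine; apply: eq_bigr => i _.
by rewrite /integ /Rintegral fineK//; apply: integrable_fin_num => //; exact: fi.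
Qed.

Lemma integ_le a b f g : L1 a b f -> L1 a b g ->
  (forall t, a <= t <= b -> f t <= g t) -> integ a b f <= integ a b g.
Proof.
by move=> f1 g1 fg; apply: le_Rintegral => // t /=; rewrite in_itv/=; exact: fg.
Qed.

Lemma integ_ge0 a b f : (forall t, a <= t <= b -> 0 <= f t) -> 0 <= integ a b f.
Proof.
by move=> fg; apply: Rintegral_ge0 => // t /=; rewrite in_itv/=; exact: fg.
Qed.

Lemma integ_norm a b f : L1 a b f -> `|integ a b f| <= integ a b (fun t => `|f t|).
Proof. by move=> f1; apply: le_normr_Rintegral. Qed.

Lemma integ_cst a b r : a <= b -> integ a b (cst r) = r * (b - a).
Proof.
move=> ab; rewrite /integ Rintegral_cst//= lebesgue_measure_itv/=.
case: ifPn => [|]; rewrite lte_fin; first by rewrite -EFinB.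
rewrite -leNgt => ba; have -> : b = a by apply/le_anti; rewrite ab ba.
by rewrite subrr.
Qed.

Lemma integ_pt a f : integ a a f = 0.
Proof. by rewrite /integ set_itv1 Rintegral_set1. Qed.

Lemma integ_split a b c f : a <= c -> c <= b -> L1 a b f ->
  integ a b f = integ a c f + integ c b f.
Proof.
move=> ac cb f1.
have := @Rintegral_itvB _ f (BLeft a) (BRight b) c f1.
rewrite !bnd_simp => /(_ ac cb) h.
rewrite /integ -(@Rintegral_itv_obnd_cbnd _ c); first by rewrite -h; ring.
by apply: integrableS f1 => //; apply: subset_itvr; rewrite bnd_simp.
Qed.

Lemma L1_glue a b c f : a <= c -> c <= b -> L1 a c f -> L1 c b f -> L1 a b f.
Proof.
move=> ac cb f1 f2.
have E : `[a, b]%classic = `[a, c]%classic `|` `]c, b]%classic.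
  by apply: itv_bndbnd_setU; rewrite bnd_simp.
have {f2} : mu.-integrable `]c, b] (EFin \o f).
  by apply: integrableS f2 => //; apply: subset_itvr; rewrite bnd_simp.
rewrite /L1 E; move: f1 => /integrableP[m1 i1] /integrableP[m2 i2].
have m12 : measurable_fun (`[a, c]%classic `|` `]c, b]%classic) (EFin \o f).
  by apply/measurable_funU.
apply/integrableP; split => //.
rewrite ge0_integral_setU//.
- exact: lte_add_pinfty.
- by apply: (measurableT_comp _ m12).
- apply/disj_setPS => y [/=]; rewrite 2!in_itv/= => /andP[_ yx] /andP[].
  by move=> cy; move: (lt_le_trans cy yx); rewrite ltxx.
Qed.

Lemma integ_continuous a b f : a <= b -> L1 a b f ->
  {within `[a, b], continuous (fun t => integ a t f)}.
Proof. exact: parameterized_integral_continuous. Qed.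

Lemma ae_sub (P Q : set R) : P `<=` Q ->
  {ae mu, forall t, P t} -> {ae mu, forall t, Q t}.
Proof. exact: (@filterS _ (almost_everywhere mu) _). Qed.

Lemma ae_integ_eq a b f g : L1 a b f -> measurable_fun `[a, b] g ->
  {ae mu, forall t, `[a, b]%classic t -> f t = g t} -> integ a b f = integ a b g.
Proof.
move=> /L1_measurable/measurable_EFinP f1 /measurable_EFinP mg fg.
rewrite /integ /Rintegral; congr fine.
apply: (@ae_eq_integral _ (measurableTypeR R) R mu _ _ _ (mseg a b) f1 mg).
by move: fg; apply: ae_sub => t /= h tab; rewrite h.
Qed.

Lemma ae_integ_ge0 a b f : L1 a b f ->
  {ae mu, forall t, `[a, b]%classic t -> 0 <= f t} -> 0 <= integ a b f.
Proof.
move=> f1 f0; rewrite (@ae_integ_eq a b f (fun t => Num.max (f t) 0))//.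
- by apply: integ_ge0 => t _; rewrite le_max lexx orbT.
- by apply: measurable_maxr => //; exact: L1_measurable.
- by move: f0; apply: ae_sub => t h /h f0; rewrite max_l.
Qed.

Lemma measurable_oo a b f g : a <= b -> (forall t, a < t < b -> f t = g t) ->
  measurable_fun `[a, b] f -> measurable_fun `[a, b] g.
Proof.
move=> ab fg mf; case: (eqVneq a b) => [->|ab'].
  by rewrite set_itv1; exact: measurable_fun_set1.
have lab : a < b by rewrite lt_neqAle ab' ab.
have E : `[a, b]%classic = [set a] `|` `]a, b[%classic `|` [set b].
  by rewrite setU1itv ?setUitv1 ?bnd_simp.
rewrite E; apply/measurable_funU => //; first by apply: measurableU.
split; last exact: measurable_fun_set1.
apply/measurable_funU => //; split; first exact: measurable_fun_set1.
apply: (@eq_measurable_fun _ _ _ _ _ f).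
  by move=> t; rewrite inE/= in_itv/= => /fg.
by apply: measurable_funS mf => //; exact: subset_itv_oo_cc.
Qed.

Lemma L1_ae a b f g : measurable_fun `[a, b] g ->
  {ae mu, forall t, `[a, b]%classic t -> f t = g t} -> L1 a b f -> L1 a b g.
Proof.
move=> mg fg f1; have mf := L1_measurable f1; move: f1 => /integrableP[_ f1].
apply/integrableP; split; first by apply/measurable_EFinP.
move: f1; congr (_ < _)%E.
have mnorm h : measurable_fun `[a, b] h ->
    measurable_fun `[a, b] (fun t => `|(h t)%:E|%E).
  by move=> /measurable_EFinP mh; apply: (measurableT_comp _ mh).
apply: (@ae_eq_integral _ (measurableTypeR R) R mu _ _ _ (mseg a b)
  (mnorm _ mf) (mnorm _ mg)).
by move: fg; apply: ae_sub => t h tab /=; rewrite h.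
Qed.

(** The values at the end points do not matter; this allows functions that are
controlled only inside a piece, such as P and its derivative. *)
Lemma L1_oo a b f g : a <= b -> (forall t, a < t < b -> f t = g t) ->
  L1 a b f -> L1 a b g /\ integ a b g = integ a b f.
Proof.
move=> ab fg f1.
have mg := measurable_oo ab fg (L1_measurable f1).
have aefg : {ae mu, forall t, `[a, b]%classic t -> f t = g t}.
  exists [set a; b]; split => //; first exact: measurableU.
    by apply: countable_lebesgue_measure0; exact: finite_set_countable.
  move=> t /= /not_implyP[]; rewrite in_itv/= => /andP[at_ tb] ne.
  apply: contrapT => /not_orP[/eqP ta /eqP tb']; apply: ne.
  by rewrite fg// !lt_neqAle at_ tb tb' eq_sym ta.
by split; [exact: L1_ae f1|rewrite (ae_integ_eq f1 mg)].
Qed.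

End SegmentIntegral.

(** * Absolutely continuous functions *)
Section Primitives.
Context {R : realType}.
Local Notation mu := (@lebesgue_measure R).
Implicit Types (a b c d : R) (f g h p q y : R -> R).

(** Absolute continuity of the integral, uniformly in the position of the short
interval. *)
Lemma integ_small a b f e : L1 a b f -> 0 < e ->
  exists2 r, 0 < r & forall s t, a <= s -> s <= t -> t <= b -> t - s < r ->
    integ s t (fun x => `|f x|) < e.
Proof.
move=> f1 e0.
have : mu.-integrable setT (EFin \o (f \_ `[a, b])).
  by rewrite -restrict_EFin; apply/integrable_restrict => //=; rewrite setTI.
move=> /integral_normr_continuous /(_ _ e0)[r [r0 /= H]].
exists r => // s t as_ st tb tsr.
have /H : (mu `[s, t] < r%:E)%E.
  by rewrite lebesgue_measure_itv/= lte_fin; case: ifPn.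
move=> /(_ (measurable_itv _)); apply: le_lt_trans.
rewrite le_eqVlt; apply/orP; left; apply/eqP; apply: eq_Rintegral => x.
rewrite inE/= in_itv/= => /andP[sx xt].
by rewrite patchE mem_set//= in_itv/= (le_trans as_ sx) (le_trans xt tb).
Qed.

(** Suppose that for every e the increments of f on short enough intervals are at
most e times those of a fixed h. Cutting [c, d] into equal short intervals gives
an increment of at most e (h d - h c), for every e. The increments of a product
deviate from the expected integral in exactly this way, which gives the product
rule without Fubini or a.e. differentiation. *)
Lemma eq_of_small_increments c d f h : c <= d ->
  (forall e, 0 < e -> exists2 r, 0 < r & forall s t,
     c <= s -> s <= t -> t <= d -> t - s < r ->
     `|f t - f s| <= e * (h t - h s)) ->
  f d = f c.
Proof.
move=> cd H; apply/eqP; rewrite -subr_eq0 -normr_eq0 eq_le normr_ge0 andbT.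
have dc0 : 0 <= d - c by rewrite subr_ge0.
have K e : 0 < e -> `|f d - f c| <= e * (h d - h c).
  move=> e0; have [r r0 Hr] := H e e0.
  (* n equal steps w = (d - c) / n, each shorter than r *)
  have /archi_boundP := divr_ge0 dc0 (ltW r0).
  set n := Num.bound _ => nb.
  have n0 : 0 < n%:R :> R.
    by apply: le_lt_trans nb; rewrite divr_ge0// ltW.
  pose w := (d - c) / n%:R; pose x i := c + i%:R * w.
  have w0 : 0 <= w by rewrite divr_ge0// ltW.
  have wr : w < r by rewrite ltr_pdivrMr// mulrC -ltr_pdivrMr.
  have xn : x n = d by rewrite /x /w mulrC divfK ?gt_eqF//; ring.
  have xS i : x i.+1 = x i + w by rewrite /x -natr1; ring.
  have xc i : c <= x i by rewrite lerDl mulr_ge0.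
  have xd i : (i <= n)%N -> x i <= d.
    by move=> i_n; rewrite -xn lerD2l ler_wpM2r// ler_nat.
  suff : forall i, (i <= n)%N -> `|f (x i) - f c| <= e * (h (x i) - h c).
    by move/(_ n (leqnn _)); rewrite xn.
  elim=> [_|i IH i_n].
    by rewrite /x mul0r addr0 !subrr normr0 mulr0.
  have := Hr (x i) (x i.+1) (xc i); rewrite {1 3}xS lerDl w0 => /(_ isT (xd _ i_n)).
  rewrite addrAC subrr add0r => /(_ wr) h1.
  rewrite (_ : f _ - f c = (f (x i.+1) - f (x i)) + (f (x i) - f c)); last by ring.
  apply: le_trans (ler_normD _ _) _.
  apply: le_trans (lerD h1 (IH (ltnW i_n))) _.
  by rewrite -mulrDr le_eqVlt; apply/orP; left; apply/eqP; congr (_ * _); ring.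
have [hdc|hdc] := leP (h d - h c) 0.
  by apply: le_trans (K _ ltr01) _; rewrite mul1r.
apply/ler_addgt0Pl => e e0; rewrite addr0.
apply: le_trans (K (e / (h d - h c)) _) _; first by rewrite divr_gt0.
by rewrite divfK ?gt_eqF.
Qed.

(** Absolute continuity on [c, d] with a.e. derivative q, in integral form, so
that no pointwise derivative of a state ever has to be taken. *)
Definition primitive c d p q : Prop :=
  L1 c d q /\ forall t, c <= t <= d -> p t = p c + integ c t q.

Lemma primitive_incr c d p q s t : primitive c d p q ->
  c <= s -> s <= t -> t <= d -> p t - p s = integ s t q.
Proof.
move=> [q1 pq] cs st td.
rewrite (pq t) ?(le_trans cs)// (pq s) ?cs ?(le_trans st)//.
rewrite (@integ_split _ c t s)//; first by ring.
exact: L1_sub q1.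
Qed.

Lemma primitive_bounded c d p q t : primitive c d p q -> c <= t <= d ->
  `|p t| <= `|p c| + integ c d (fun x => `|q x|).
Proof.
move=> [q1 pq] /andP[ct td]; rewrite pq ?ct//.
apply: le_trans (ler_normD _ _) _; rewrite lerD2l.
have q2 : L1 c t q by exact: L1_sub q1.
apply: le_trans (integ_norm q2) _.
rewrite [leRHS](@integ_split _ c d t)//; last exact: L1_norm.
by rewrite lerDl integ_ge0.
Qed.

Lemma primitive_continuous c d p q : c <= d -> primitive c d p q ->
  {within `[c, d], continuous p}.
Proof.
move=> cd [q1 pq].
have := integ_continuous cd q1.
have pE : {in `[c, d], (fun t => p c + integ c t q) =1 p}.
  by move=> t; rewrite in_itv/= => /pq.
move=> cq.
apply: (@subspace_eq_continuous _ _ _ (fun t => p c + integ c t q)).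
  by move=> t; rewrite inE/= => tcd; rewrite pE.
move=> t; apply: (@cvgD _ R^o); first exact: cvg_cst.
exact: cq.
Qed.

Lemma primitive_measurable c d p q : c <= d -> primitive c d p q ->
  measurable_fun `[c, d] p.
Proof.
move=> cd /(primitive_continuous cd).
by apply: subspace_continuous_measurable_fun.
Qed.

(** On [s, t] the increment of p y minus the integral of q y + p g equals the
integral of q (y t - y) + (p s - p) g. For t - s small the two differences are
smaller than e, so this is at most e times the integral of |q| + |g|. *)
Lemma primitiveM c d p q y g : c <= d ->
  primitive c d p q -> primitive c d y g ->
  primitive c d (fun t => p t * y t) (fun t => q t * y t + p t * g t).
Proof.
move=> cd pq yg; have [q1 _] := pq; have [g1 _] := yg.
have qy1 : L1 c d (fun t => q t * y t).
  apply: (@L1_eq _ _ _ (fun t => y t * q t)); first by move=> t _; rewrite mulrC.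
  apply: L1M_bounded q1; first exact: primitive_measurable yg.
  by move=> t; exact: primitive_bounded yg.
have pg1 : L1 c d (fun t => p t * g t).
  apply: L1M_bounded g1; first exact: primitive_measurable pq.
  by move=> t; exact: primitive_bounded pq.
have i1 := L1D qy1 pg1.
split=> // t0 /andP[ct0 t0d].
pose h t := integ c t (fun x => `|q x|) + integ c t (fun x => `|g x|).
pose f t := p t * y t - integ c t (fun t => q t * y t + p t * g t).
suff : f t0 = f c by rewrite /f integ_pt => /eqP; rewrite subr0 subr_eq => /eqP.
apply: (@eq_of_small_increments _ _ _ h) => // e e0.
have [r1 r10 H1] := integ_small q1 e0.
have [r2 r20 H2] := integ_small g1 e0.
exists (Num.min r1 r2); first by rewrite lt_min r10.
move=> s t cs st tt0; rewrite lt_min => /andP[tr1 tr2].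
have td := le_trans tt0 t0d.
have sub f0 : L1 c d f0 -> L1 s t f0 by exact: L1_sub.
have split_ f0 : L1 c d f0 -> integ c t f0 = integ c s f0 + integ s t f0.
  by move=> f01; apply: integ_split => //; apply: L1_sub f01.
have -> : h t - h s = integ s t (fun x => `|q x|) + integ s t (fun x => `|g x|).
  by rewrite /h !split_; [ring|exact: L1_norm..].
have -> : f t - f s = integ s t (fun x => q x * (y t - y x) + (p s - p x) * g x).
  have -> : integ s t (fun x => q x * (y t - y x) + (p s - p x) * g x) =
    integ s t (fun x => (y t * q x + p s * g x) - (q x * y x + p x * g x)).
    by apply: integ_eq => x _; ring.
  rewrite integB; [|by apply: L1D; apply: L1Z; apply: sub|exact: sub].
  rewrite integD; [|by apply: L1Z; apply: sub..].
  rewrite !integZ; [|exact: sub..].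
  rewrite -(primitive_incr pq)// -(primitive_incr yg)// /f split_//.
  by ring.
have L : L1 s t (fun x => q x * (y t - y x) + (p s - p x) * g x).
  apply: (@L1_eq _ _ _ (fun x => (y t * q x + p s * g x) - (q x * y x + p x * g x))).
    by move=> x _; ring.
  apply: L1B; last exact: sub.
  by apply: L1D; apply: L1Z; apply: sub.
apply: le_trans (integ_norm L) _.
have Lq := L1_norm (sub _ q1); have Lg := L1_norm (sub _ g1).
rewrite -integD// -integZ; last exact: L1D.
apply: integ_le; [exact: L1_norm|by apply/L1Z/L1D|].
move=> x /andP[sx xt].
apply: le_trans (ler_normD _ _) _; rewrite !normrM mulrDr [`|q x| * _]mulrC.
apply: lerD; apply: ler_wpM2r => //.
  rewrite (primitive_incr yg) ?(le_trans cs)//.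
  apply: le_trans (integ_norm _) _; first by apply: L1_sub g1; rewrite ?(le_trans cs).
  apply: ltW; apply: H2 => //; first exact: (le_trans cs).
  by apply: le_lt_trans tr2; rewrite lerB.
rewrite distrC (primitive_incr pq) ?(le_trans xt)//.
apply: le_trans (integ_norm _) _; first by apply: L1_sub q1; rewrite ?(le_trans xt).
apply: ltW; apply: H1 => //; first exact: (le_trans xt).
by apply: le_lt_trans tr1; rewrite lerB.
Qed.

Lemma primitive_eq c d p p' q q' : (forall t, c <= t <= d -> p t = p' t) ->
  (forall t, c <= t <= d -> q t = q' t) -> c <= d ->
  primitive c d p q -> primitive c d p' q'.
Proof.
move=> pp qq cd [q1 pq]; split; first exact: L1_eq q1.
move=> t tcd; rewrite -!pp ?lexx ?cd// pq//; congr (_ + _); apply: integ_eq => x /andP[cx xt].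
by apply: qq; rewrite cx (le_trans xt)//; case/andP: tcd.
Qed.

(** For a primitive m of k this evaluates the integral of k m^n, which turns the
n-th term of the exponential series, as a bound on a Picard iterate, into the
next one. *)
Lemma primitiveX c d p q n : c <= d -> primitive c d p q ->
  primitive c d (fun t => p t ^+ n.+1) (fun t => n.+1%:R * (q t * p t ^+ n)).
Proof.
move=> cd pq; elim: n => [|n IH].
  by apply: primitive_eq pq => // t _; rewrite mul1r expr0 mulr1.
apply: primitive_eq (primitiveM cd pq IH) => // t _.
by rewrite -[in RHS]natr1 mulrDl mul1r exprS; ring.
Qed.

Lemma primitive_sum c d (I : finType) (p q : I -> R -> R) :
  (forall i, primitive c d (p i) (q i)) ->
  primitive c d (fun t => \sum_i p i t) (fun t => \sum_i q i t).
Proof.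
move=> pq; split; first by apply: L1_sum => i; have [] := pq i.
move=> t /andP[ct td]; rewrite integ_sum; last first.
  by move=> i; have [q1 _] := pq i; apply: L1_sub q1.
rewrite -big_split/=; apply: eq_bigr => i _; have [_ ->//] := pq i.
by rewrite ct.
Qed.

End Primitives.

(** * Linear integral equations with integrable coefficients *)
Lemma cvg_sum {R : realType} T (F : set_system T) {FF : Filter F} (I : finType)
    (f : I -> T -> R) (l : I -> R) :
  (forall i, f i x @[x --> F] --> l i) ->
  \sum_i f i x @[x --> F] --> \sum_i l i.
Proof.
move=> fl; rewrite !unlock; elim: (index_enum I) => [|i s IH] /=.
  exact: cvg_cst.
exact: cvgD.
Qed.

Lemma integ_dominated_cvg {R : realType} (a b : R) (f_ : nat -> R -> R)
    (f g : R -> R) :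
  (forall n, measurable_fun `[a, b] (f_ n)) ->
  (forall t, a <= t <= b -> f_ n t @[n --> \oo] --> f t) ->
  L1 a b g -> (forall n t, a <= t <= b -> `|f_ n t| <= g t) ->
  L1 a b f /\ integ a b (f_ n) @[n --> \oo] --> integ a b f.
Proof.
move=> mf_ f_f g1 f_g.
have mf : measurable_fun `[a, b] f.
  by apply: (measurable_fun_cvg mf_) => t /=; rewrite in_itv/=; exact: f_f.
have f_f' : {ae @lebesgue_measure R, forall t, `[a, b]%classic t ->
    (EFin \o f_ n) t @[n --> \oo] --> (EFin \o f) t}.
  by apply: aeW => t /=; rewrite in_itv/= => /f_f h; apply: cvg_EFin => //; exact: nearW.
have f_g' : {ae @lebesgue_measure R, forall t n, `[a, b]%classic t ->
    (`|(EFin \o f_ n) t| <= (EFin \o g) t)%E}.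
  by apply: aeW => t n /=; rewrite in_itv/= => /f_g; rewrite lee_fin.
have [f1 _ If] := @dominated_convergence _ (measurableTypeR R) R
  (@lebesgue_measure R) `[a, b] (measurable_itv _)
  (fun n => EFin \o f_ n) (EFin \o f) (EFin \o g)
  (fun n => (iffRL (measurable_EFinP _ _)) (mf_ n))
  ((iffRL (measurable_EFinP _ _)) mf) f_f' g1 f_g'.
split=> //.
apply: fine_cvg; rewrite fineK; last exact: integrable_fin_num.
exact: If.
Qed.

Section LinearODE.
Context {R : realType}.
Context (I : finType) (c d : R) (a : I -> I -> R -> R) (k : R -> R).
Context (y0 : I -> R) (B : R).
Context (cd : c <= d) (a1 : forall i j, L1 c d (a i j)) (k1 : L1 c d k).
Context (k0 : forall t, c <= t <= d -> 0 <= k t).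
Context (ak : forall i t, c <= t <= d -> \sum_j `|a i j t| <= k t).
Context (y0B : forall i, `|y0 i| <= B).

Let rhs (u : I -> R -> R) i t := \sum_j a i j t * u j t.

Fixpoint picard n i t : R :=
  if n is n'.+1 then integ c t (rhs (picard n') i) else y0 i.

Let m t := integ c t k.

Let cprim : primitive c d m k.
Proof. by split=> // t tcd; rewrite /m integ_pt add0r. Qed.

Let m_le t : c <= t <= d -> 0 <= m t <= m d.
Proof.
move=> /andP[ct td]; apply/andP; split.
  by apply: integ_ge0 => s /andP[cs st]; apply: k0; rewrite cs (le_trans st).
rewrite -subr_ge0 (primitive_incr cprim)//; apply: integ_ge0 => s /andP[ts sd].
by apply: k0; rewrite sd (le_trans ct).
Qed.

Let B0 (i : I) : 0 <= B.
Proof. exact: le_trans (y0B i). Qed.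

Let rhs_le (u : I -> R -> R) i t (M : R) : c <= t <= d ->
  (forall j, `|u j t| <= M) -> `|rhs u i t| <= k t * M.
Proof.
move=> tcd uM; apply: le_trans (ler_norm_sum _ _ _) _.
have M0 : 0 <= M by exact: le_trans (uM i).
apply: le_trans (ler_wpM2r M0 (ak i tcd)); rewrite mulr_suml.
by apply: ler_sum => j _; rewrite normrM ler_wpM2l.
Qed.

Let rhs_measurable (u : I -> R -> R) i :
  (forall j, measurable_fun `[c, d] (u j)) -> measurable_fun `[c, d] (rhs u i).
Proof.
move=> mu_; apply: measurable_sum => j; apply: measurable_funM => //.
exact: L1_measurable.
Qed.

Let exp_coeff_le t n : c <= t <= d -> exp_coeff (m t) n <= exp_coeff (m d) n.
Proof.
move=> /m_le/andP[m0 mE]; rewrite /exp_coeff/= ler_wpM2r ?invr_ge0//.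
by rewrite lerXn2r ?nnegrE// (le_trans m0).
Qed.

Let rhs_L1 (u : I -> R -> R) i (M : R) :
  (forall j, measurable_fun `[c, d] (u j)) ->
  (forall j t, c <= t <= d -> `|u j t| <= M) -> L1 c d (rhs u i).
Proof.
move=> mu_ uM; apply: (@L1_le _ _ _ _ (fun t => M * k t)).
- exact: rhs_measurable.
- by move=> t tcd; rewrite mulrC; apply: rhs_le => // j; exact: uM.
- exact: L1Z.
Qed.

Let picard_bound n : (forall i, measurable_fun `[c, d] (picard n i)) /\
  forall i t, c <= t <= d -> `|picard n i t| <= B * exp_coeff (m t) n.
Proof.
elim: n => [|n [IHm IH]]; split.
- by move=> i; exact: measurable_cst.
- by move=> i t tcd; rewrite /exp_coeff/= expr0 fact0 divr1 mulr1.
- move=> i; apply: (@primitive_measurable _ _ _ _ (rhs (picard n) i)) => //.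
  split; last by move=> t _ /=; rewrite integ_pt add0r.
  apply: (@rhs_L1 _ _ (B * exp_coeff (m d) n)) => // j t tcd.
  apply: le_trans (IH j t tcd) _.
  by apply: ler_wpM2l; [exact: B0 i|exact: exp_coeff_le].
- move=> i t /andP[ct td] /=.
  have r1 : L1 c t (rhs (picard n) i).
    apply: (@L1_sub _ c d) => //.
    apply: (@rhs_L1 _ _ (B * exp_coeff (m d) n)) => // j s scd.
    apply: le_trans (IH j s scd) _.
    by apply: ler_wpM2l; [exact: B0 i|exact: exp_coeff_le].
  apply: le_trans (integ_norm r1) _.
  have [l1 mX] := primitiveX n cd cprim.
  have -> : B * exp_coeff (m t) n.+1 = integ c t
      (fun s => (B / n.+1`!%:R) * (n.+1%:R * (k s * m s ^+ n))).
    rewrite integZ; last exact: L1_sub l1.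
    rewrite /exp_coeff/= mX ?ct// /m integ_pt expr0n/= add0r mulrA.
    by rewrite mulrAC.
  apply: integ_le; [exact: L1_norm|by apply/L1Z/(L1_sub _ _ l1)|].
  move=> s /andP[cs st]; have scd : c <= s <= d by rewrite cs (le_trans st).
  apply: (@le_trans _ _ (k s * (B * exp_coeff (m s) n))).
    by apply: rhs_le => // j; exact: IH.
  rewrite le_eqVlt; apply/orP; left; apply/eqP; rewrite /exp_coeff/=.
  rewrite factS natrM; field.
  by rewrite nat1r !pnatr_eq0 -lt0n fact_gt0.
Qed.

Let picard_sum N i t := \sum_(0 <= n < N) picard n i t.

Let E := expR (m d).

Let md0 : 0 <= m d. Proof. by have /andP[] := m_le (introT andP (conj cd (lexx d))). Qed.

Let picard_sum_le N i t : c <= t <= d -> `|picard_sum N i t| <= B * E.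
Proof.
move=> tcd; apply: le_trans (ler_norm_sum _ _ _) _.
apply: (@le_trans _ _ (B * series (exp_coeff (m d)) N)).
  rewrite /series/= mulr_sumr; apply: ler_sum => n _.
  apply: le_trans ((picard_bound n).2 i t tcd) _.
  by apply: ler_wpM2l; [exact: B0 i|exact: exp_coeff_le].
apply: ler_wpM2l; first exact: B0 i.
apply: nondecreasing_cvgn_le; last exact: is_cvg_series_exp_coeff.
by apply: nondecreasing_series => n _ _; exact: (exp_coeff_ge0 _ md0).
Qed.

Let picard_cvg i t : c <= t <= d -> cvgn (series (fun n => picard n i t)).
Proof.
move=> tcd; apply: normed_cvg.
apply: (@series_le_cvg _ _ (fun n => B * exp_coeff (m d) n)).
- by move=> n /=.
- by move=> n; apply: mulr_ge0; [exact: B0 i|exact: exp_coeff_ge0].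
- move=> n; apply: le_trans ((picard_bound n).2 i t tcd) _.
  by apply: ler_wpM2l; [exact: B0 i|exact: exp_coeff_le].
- rewrite (_ : series _ = fun N => B * series (exp_coeff (m d)) N); last first.
    by apply/funext => N; rewrite /series/= mulr_sumr.
  by apply: is_cvgM; [exact: is_cvg_cst|exact: is_cvg_series_exp_coeff].
Qed.

Let y i t := limn (series (fun n => picard n i t)).

(** The solution is the sum of the Picard iterates, each the integral of the
right-hand side at the previous one. The n-th is at most B m^n / n!, where m is
the primitive of k. So the sum converges with the bound B exp (m d), and
dominated convergence passes to the limit in the integral equation. The bound
involves the coefficients only through k. *)
Lemma linear_ode : exists z : I -> R -> R, forall i,
  [/\ primitive c d (z i) (fun t => \sum_j a i j t * z j t), z i c = y0 i &
      forall t, c <= t <= d -> `|z i t| <= B * expR (integ c d k)].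
Proof.
have mS N j : measurable_fun `[c, d] (picard_sum N j).
  by apply: measurable_sum => n; exact: (picard_bound n).1.
have yle i t : c <= t <= d -> `|y i t| <= B * E.
  move=> tcd; have cy := @picard_cvg i t tcd; rewrite ler_norml; apply/andP; split.
    apply: limr_ge => //; apply: nearW => N.
    by have := @picard_sum_le N i t tcd; rewrite ler_norml => /andP[].
  apply: limr_le => //; apply: nearW => N.
  by have := @picard_sum_le N i t tcd; rewrite ler_norml => /andP[].
have L N i t : c <= t <= d -> picard_sum N.+1 i t =
    y0 i + integ c t (rhs (picard_sum N) i).
  move=> /andP[ct td]; rewrite /picard_sum big_nat_recl//; congr (_ + _).
  rewrite big_mkord -integ_sum/=; last first.
    move=> n; apply: (@L1_sub _ c d) => //.
    apply: (@rhs_L1 _ _ (B * exp_coeff (m d) n)) => [j|j s scd].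
      exact: (picard_bound n).1.
    apply: le_trans ((picard_bound n).2 j s scd) _.
    by apply: ler_wpM2l; [exact: B0 i|exact: exp_coeff_le].
  apply: integ_eq => s _; rewrite /rhs exchange_big/=; apply: eq_bigr => j _.
  by rewrite big_mkord mulr_sumr.
have key i t : c <= t <= d -> L1 c t (rhs y i) /\ y i t = y0 i + integ c t (rhs y i).
  move=> /andP[ct td].
  have sub s : c <= s <= t -> c <= s <= d.
    by move=> /andP[-> st]; exact: le_trans st td.
  have [f1 If] : L1 c t (rhs y i) /\
      integ c t (rhs (picard_sum N) i) @[N --> \oo] --> integ c t (rhs y i).
    apply: (@integ_dominated_cvg _ _ _ _ _ (fun s => k s * (B * E))).
    - move=> N; apply: (@measurable_funS _ _ _ _ `[c, d]) => //.
      exact: rhs_measurable.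
    - move=> s /sub scd; apply: cvg_sum => j; apply: cvgMl_tmp.
      exact: picard_cvg.
    - apply: (@L1_eq _ _ _ (fun s => (B * E) * k s)).
        by move=> s _; rewrite mulrC.
      by apply/L1Z/(L1_sub _ _ k1).
    - by move=> N s /sub scd; apply: rhs_le => // j; exact: picard_sum_le.
  split=> //; apply: (@cvg_unique _ _ (picard_sum N.+1 i t @[N --> \oo])) => //.
    have := @picard_cvg i t; rewrite ct td => /(_ isT) h.
    have := cvg_shiftS (fun N => picard_sum N i t) (nbhs (y i t)).
    by rewrite /= => ->.
  rewrite /mkset (_ : (fun N => _) = fun N => y0 i + integ c t (rhs (picard_sum N) i)).
    by apply: cvgD => //; exact: cvg_cst.
  by apply/funext => N; rewrite L ?ct.
exists y => i.
have yc : y i c = y0 i.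
  by have [_ ->] := key i c (introT andP (conj (lexx c) cd)); rewrite integ_pt addr0.
split=> //; last exact: yle.
split; first by have [] := key i d (introT andP (conj cd (lexx d))).
by move=> t tcd; have [_ ->] := key i t tcd; rewrite yc.
Qed.

End LinearODE.

(** * Real coordinates of complex matrices *)
Section Coordinates.
Context {R : realType}.
Implicit Types (p q r : nat).

(** The coordinates are indexed by triples (i, j, e), where e selects the
imaginary part. Finite sums over them replace arguments by entries and parts. *)
Definition cr p q (k : 'I_p * 'I_q * bool) (A : 'M[R[i]]_(p, q)) : R :=
  if k.2 then complex.Im (A k.1.1 k.1.2) else complex.Re (A k.1.1 k.1.2).

Lemma conjCE (z : R[i]) : Num.conj z = (complex.Re z -i* complex.Im z).
Proof. by case: z. Qed.

Lemma cr_inj p q (A B : 'M[R[i]]_(p, q)) : (forall k, cr k A = cr k B) -> A = B.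
Proof.
move=> AB; apply/matrixP => i j; apply/eqP; rewrite eq_complex.
by rewrite (AB (i, j, false) : complex.Re _ = _) (AB (i, j, true) : complex.Im _ = _) !eqxx.
Qed.

Lemma cr0 p q k : cr k (0 : 'M[R[i]]_(p, q)) = 0.
Proof. by rewrite /cr !mxE; case: k.2. Qed.

Lemma crD p q k (A B : 'M[R[i]]_(p, q)) : cr k (A + B) = cr k A + cr k B.
Proof. by rewrite /cr !mxE; case: k.2; rewrite raddfD. Qed.

Lemma crN p q k (A : 'M[R[i]]_(p, q)) : cr k (- A) = - cr k A.
Proof. by rewrite /cr !mxE; case: k.2; rewrite raddfN. Qed.

Lemma crZ p q k (a : R) (A : 'M[R[i]]_(p, q)) : cr k (a%:C *: A) = a * cr k A.
Proof.
rewrite /cr !mxE; case: (A _ _) => x y /=; case: k.2 => /=.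
  by rewrite mul0r addr0.
by rewrite mul0r subr0.
Qed.

Lemma cr_sum p q k (I : finType) (A : I -> 'M[R[i]]_(p, q)) :
  cr k (\sum_i A i) = \sum_i cr k (A i).
Proof.
rewrite !unlock; elim: (index_enum I) => [|i s IH] /=; first exact: cr0.
by rewrite crD IH.
Qed.

Lemma cr_op p q k (op : (R -> R) -> R) (A : R -> 'M[R[i]]_(p, q)) :
  cr k (mx_op op A) = op (fun t => cr k (A t)).
Proof. by rewrite /cr !mxE; case: k.2. Qed.

Lemma mx_allP Q p q (A : R -> 'M[R[i]]_(p, q)) :
  mx_all Q A <-> forall k, Q (fun t => cr k (A t)).
Proof.
split=> [H [[i j] []]|H i j]; first exact: (H i j).2.
- exact: (H i j).1.
- by split; [exact: (H (i, j, false))|exact: (H (i, j, true))].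
Qed.

Lemma mx_cvgP (G : set_system R) p q (A : R -> 'M[R[i]]_(p, q)) B :
  mx_cvg G A B <-> forall k, cr k (A t) @[t --> G] --> cr k B.
Proof.
split=> [H [[i j] []]|H i j]; first exact: (H i j).2.
- exact: (H i j).1.
- by split; [exact: (H (i, j, false))|exact: (H (i, j, true))].
Qed.

Lemma cr_mul p q r i j e (A : 'M[R[i]]_(p, q)) (B : 'M[R[i]]_(q, r)) :
  cr (i, j, e) (A *m B) = \sum_l
    (cr (i, l, false) A * cr (l, j, e) B +
     (if e then 1 else -1) * (cr (i, l, true) A * cr (l, j, ~~ e) B)).
Proof.
rewrite /cr/= !mxE; case: e => /=; rewrite raddf_sum/=; apply: eq_bigr => l _.
  by case: (A i l) => a b; case: (B l j) => c d /=; rewrite mul1r.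
by case: (A i l) => a b; case: (B l j) => c d /=; rewrite mulN1r.
Qed.

Lemma cr_ctr p q i j e (A : 'M[R[i]]_(p, q)) :
  cr (i, j, e) (A^t*) = (if e then -1 else 1) * cr (j, i, e) A.
Proof.
by rewrite /cr/= !mxE conjCE; case: e => /=; rewrite ?mulN1r ?mul1r.
Qed.

(** In these coordinates the pairing is the Euclidean one, so limits, measurability
and derivatives of pairings reduce to finite sums of products of reals. *)
Lemma innerE p (A B : 'M[R[i]]_p) : inner A B = \sum_k cr k A * cr k B.
Proof.
rewrite /inner /mxtrace raddf_sum/=.
rewrite -(pair_bigA _ (fun (ij : 'I_p * 'I_p) (e : bool) =>
  cr (ij, e) A * cr (ij, e) B))/=.
rewrite -(pair_bigA _ (fun i j => \sum_(e : bool) cr (i, j, e) A * cr (i, j, e) B))/=.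
apply: eq_bigr => i _; rewrite !mxE raddf_sum/=; apply: eq_bigr => j _.
rewrite !mxE conjCE big_bool /cr/=.
by case: (A i j) => a b; case: (B i j) => c d /=; rewrite mulrN opprK addrC.
Qed.

Lemma innerC p (A B : 'M[R[i]]_p) : inner A B = inner B A.
Proof. by rewrite !innerE; apply: eq_bigr => k _; rewrite mulrC. Qed.

Lemma innerDl p (A B C : 'M[R[i]]_p) : inner (A + B) C = inner A C + inner B C.
Proof.
by rewrite !innerE -big_split; apply: eq_bigr => k _ /=; rewrite crD mulrDl.
Qed.

Lemma innerNl p (A B : 'M[R[i]]_p) : inner (- A) B = - inner A B.
Proof.
by rewrite !innerE -sumrN; apply: eq_bigr => k _ /=; rewrite crN mulNr.
Qed.

Lemma innerBl p (A B C : 'M[R[i]]_p) : inner (A - B) C = inner A C - inner B C.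
Proof. by rewrite innerDl innerNl. Qed.

Lemma inner0l p (A : 'M[R[i]]_p) : inner 0 A = 0.
Proof. by rewrite innerE big1// => k _; rewrite cr0 mul0r. Qed.

Lemma ctrM p q r (A : 'M[R[i]]_(p, q)) (B : 'M[R[i]]_(q, r)) :
  (A *m B)^t* = B^t* *m A^t*.
Proof. by rewrite trmx_mul map_mxM. Qed.

Lemma ctrD p q (A B : 'M[R[i]]_(p, q)) : (A + B)^t* = A^t* + B^t*.
Proof. by rewrite linearD map_mxD. Qed.

Lemma ctrN p q (A : 'M[R[i]]_(p, q)) : (- A)^t* = - A^t*.
Proof. by rewrite linearN map_mxN. Qed.

Lemma ctr1 p : (1%:M : 'M[R[i]]_p)^t* = 1%:M.
Proof. by rewrite trmx1 map_mx1. Qed.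

Lemma ctr0 p q : (0 : 'M[R[i]]_(p, q))^t* = 0.
Proof. by rewrite trmx0 map_mx0. Qed.

Lemma inner_congr p q (A : 'M[R[i]]_p) (V : 'M[R[i]]_(p, q)) (B : 'M[R[i]]_q) :
  inner A (V *m B *m V^t*) = inner (V^t* *m A *m V) B.
Proof.
rewrite /inner !ctrM trmxCK; congr complex.Re.
by rewrite !mulmxA mxtrace_mulC !mulmxA.
Qed.

Lemma hermP p (A : 'M[R[i]]_p) : herm A <-> A^t* = A.
Proof.
rewrite /herm; split=> [/is_hermitianmxP|AA].
  by rewrite expr0 scale1r => <-.
by apply/is_hermitianmxP; rewrite expr0 scale1r AA.
Qed.

Lemma herm_cr p (A : 'M[R[i]]_p) : herm A <->
  forall i j e, cr (i, j, e) A = (if e then -1 else 1) * cr (j, i, e) A.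
Proof.
rewrite hermP; split=> [AA i j e|H]; first by rewrite -cr_ctr AA.
by apply: cr_inj => -[[i j] e]; rewrite cr_ctr -H.
Qed.

Lemma herm0 p : herm (0 : 'M[R[i]]_p).
Proof. by apply/hermP; rewrite ctr0. Qed.

Lemma hermD p (A B : 'M[R[i]]_p) : herm A -> herm B -> herm (A + B).
Proof. by move=> /hermP hA /hermP hB; apply/hermP; rewrite ctrD hA hB. Qed.

Lemma hermN p (A : 'M[R[i]]_p) : herm A -> herm (- A).
Proof. by move=> /hermP hA; apply/hermP; rewrite ctrN hA. Qed.

Lemma herm_congr p q (V : 'M[R[i]]_(p, q)) (B : 'M[R[i]]_q) :
  herm B -> herm (V *m B *m V^t*).
Proof. by move=> /hermP hB; apply/hermP; rewrite !ctrM trmxCK hB mulmxA. Qed.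

Lemma hermZ p (a : R) (A : 'M[R[i]]_p) : herm A -> herm (a%:C *: A).
Proof.
move=> /herm_cr hA; apply/herm_cr => i j e; rewrite !crZ hA; ring.
Qed.

Lemma psd_congr p q (V : 'M[R[i]]_(p, q)) (B : 'M[R[i]]_q) :
  psd B -> psd (V *m B *m V^t*).
Proof.
move=> [hB B0]; split; first exact: herm_congr.
by move=> v; have := B0 (v *m V); rewrite ctrM !mulmxA.
Qed.

Lemma psd0 p : psd (0 : 'M[R[i]]_p).
Proof. by split=> [|v]; [exact: herm0|rewrite mulmx0 mul0mx mxE]. Qed.

(** Diagonalizing A by a unitary U turns the pairing into the sum of the
eigenvalues of A times the diagonal entries of U B U^*, all nonnegative. *)
Lemma inner_psd_ge0 p (A B : 'M[R[i]]_p) : psd A -> psd B -> 0 <= inner A B.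
Proof.
move=> [hA A0] [hB B0].
have /orthomx_spectralP := hermitian_normalmx hA.
set U := spectralmx A; set D := spectral_diag A => AE.
have Uu : U \is unitarymx := spectral_unitarymx A.
have UV : invmx U = U^t* := invmx_unitary Uu.
have UU : U *m U^t* = 1%:M by apply/unitarymxP.
have {}AE : A = U^t* *m diag_mx D *m U by rewrite {1}AE UV.
have dE i : D 0 i = (row i U *m A *m (row i U)^t*) 0 0.
  have -> : row i U *m A *m (row i U)^t* = row i (U *m A) *m (row i U)^t*.
    by rewrite row_mul.
  have -> : U *m A = diag_mx D *m U by rewrite {1}AE !mulmxA UU mul1mx.
  have -> : (row i (diag_mx D *m U) *m (row i U)^t*) 0 0 =
            (diag_mx D *m U *m U^t*) i i.
    by rewrite !mxE; apply: eq_bigr => j _; rewrite !mxE.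
  by rewrite -mulmxA UU mulmx1 mxE eqxx mulr1n.
have d0 i : 0 <= D 0 i by rewrite dE; exact: A0.
have -> : inner A B = inner (diag_mx D) (U *m B *m U^t*).
  by rewrite inner_congr -AE.
rewrite /inner /mxtrace raddf_sum; apply: sumr_ge0 => i _.
have -> : (diag_mx D *m (U *m B *m U^t*)^t*) i i =
          D 0 i * (row i U *m B *m (row i U)^t*) 0 0.
  rewrite mul_diag_mx mxE; congr (_ * _).
  have /hermP -> := herm_congr U hB.
  by rewrite -row_mul !mxE; apply: eq_bigr => j _; rewrite !mxE.
have := mulr_ge0 (d0 i) (B0 (row i U)).
by rewrite lecE => /andP[_].
Qed.

(** The cone is self-dual: the rank-one matrices v^* v already suffice as tests.
This reduces positivity of P to scalar energy inequalities. *)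
Lemma psd_of_inner p (A : 'M[R[i]]_p) : herm A ->
  (forall B, psd B -> 0 <= inner A B) -> psd A.
Proof.
move=> hA A0; split=> // v.
have hv : herm (1%:M : 'M[R[i]]_1) by apply/hermP; rewrite ctr1.
have pv : psd (v^t* *m v).
  have -> : v^t* *m v = v^t* *m 1%:M *m v^t*^t* by rewrite trmxCK mulmx1.
  apply: psd_congr; split=> // w; rewrite mulmx1 mxE.
  by apply: sumr_ge0 => i _; rewrite !mxE -normCK exprn_ge0.
have := A0 _ pv.
have -> : inner A (v^t* *m v) = complex.Re ((v *m A *m v^t*) 0 0).
  have -> : v^t* *m v = v^t* *m 1%:M *m v^t*^t* by rewrite trmxCK mulmx1.
  rewrite inner_congr trmxCK /inner ctr1 mulmx1.
  by rewrite /mxtrace big_ord1.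
have : complex.Im ((v *m A *m v^t*) 0 0) = 0.
  have /herm_cr/(_ 0 0 true) := herm_congr v hA.
  by rewrite /cr/= mulN1r => h; lra.
by rewrite lecE /= => -> ->; rewrite eqxx.
Qed.

End Coordinates.

(** * Limits of matrices *)
Section Limits.
Context {R : realType}.
Implicit Types (p q : nat).

Lemma cvg_inner (G : set_system R) {FG : Filter G} p
    (A B : R -> 'M[R[i]]_p) A0 B0 :
  mx_cvg G A A0 -> mx_cvg G B B0 ->
  inner (A t) (B t) @[t --> G] --> inner A0 B0.
Proof.
move=> /mx_cvgP cA /mx_cvgP cB.
under eq_fun do rewrite innerE; rewrite innerE.
by apply: cvg_sum => k; apply: cvgM.
Qed.

Lemma mx_cvg_cst (G : set_system R) {FG : Filter G} p q (A : 'M[R[i]]_(p, q)) :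
  mx_cvg G (fun=> A) A.
Proof. by apply/mx_cvgP => k; exact: cvg_cst. Qed.

Lemma mx_cvgM (G : set_system R) {FG : Filter G} p q r
    (A : R -> 'M[R[i]]_(p, q)) (B : R -> 'M[R[i]]_(q, r)) A0 B0 :
  mx_cvg G A A0 -> mx_cvg G B B0 -> mx_cvg G (fun t => A t *m B t) (A0 *m B0).
Proof.
move=> /mx_cvgP cA /mx_cvgP cB; apply/mx_cvgP => -[[i j] e].
under eq_fun do rewrite cr_mul; rewrite cr_mul.
apply: cvg_sum => l; apply: cvgD; first exact: cvgM.
by apply: cvgMl_tmp; exact: cvgM.
Qed.

Lemma herm_lim (G : set_system R) {FG : ProperFilter G} p (A : R -> 'M[R[i]]_p) A0 :
  mx_cvg G A A0 -> (\forall t \near G, herm (A t)) -> herm A0.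
Proof.
move=> /mx_cvgP cA hA; apply/herm_cr => i j e.
apply: (@cvg_unique _ _ (cr (i, j, e) (A t) @[t --> G])) => //.
  exact: cA.
have c2 : (if e then -1 else 1) * cr (j, i, e) (A t) @[t --> G] -->
    (if e then -1 else 1) * cr (j, i, e) A0.
  by apply: cvgMl_tmp; exact: cA.
apply: cvg_trans c2; apply: near_eq_cvg; apply: filterS hA => t /herm_cr h.
by rewrite -h.
Qed.

Lemma psd_lim (G : set_system R) {FG : ProperFilter G} p (A : R -> 'M[R[i]]_p) A0 :
  mx_cvg G A A0 -> (\forall t \near G, psd (A t)) -> psd A0.
Proof.
move=> cA pA; apply: psd_of_inner => [|B pB].
  by apply: (herm_lim cA); apply: filterS pA => t [].
have cB : inner (A t) B @[t --> G] --> inner A0 B.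
  by apply: cvg_inner => //; exact: mx_cvg_cst.
rewrite -(cvg_lim _ cB)//; apply: limr_ge; first by apply/cvg_ex; exists (inner A0 B).
by apply: filterS pA => t pt /=; exact: inner_psd_ge0.
Qed.

End Limits.

(** * A real spanning family of Hermitian matrices *)
Section HermitianBasis.
Context {R : realType}.
Implicit Types (p q : nat).

Definition hpart p (A : 'M[R[i]]_p) : 'M[R[i]]_p := (2^-1)%:C *: (A + A^t*).

Lemma herm_hpart p (A : 'M[R[i]]_p) : herm (hpart A).
Proof. by apply: hermZ; apply/hermP; rewrite ctrD trmxCK addrC. Qed.

Lemma hpart_id p (A : 'M[R[i]]_p) : herm A -> hpart A = A.
Proof.
move=> /hermP hA; rewrite /hpart hA; apply: cr_inj => k; rewrite crZ crD.
by field.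
Qed.

Lemma cr_hpart p i j e (A : 'M[R[i]]_p) : cr (i, j, e) (hpart A) =
  2^-1 * (cr (i, j, e) A + (if e then -1 else 1) * cr (j, i, e) A).
Proof. by rewrite crZ crD cr_ctr. Qed.

Definition unit_mx p (k : 'I_p * 'I_p * bool) : 'M[R[i]]_p :=
  (if k.2 then 'i else 1) *: delta_mx k.1.1 k.1.2.

(** This family, indexed by all coordinates, is redundant as (i, j) and (j, i)
give dependent matrices. In exchange no pairs i < j have to be selected, and
the coefficients of a Hermitian matrix are just its coordinates. *)
Definition hbasis p (k : 'I_p * 'I_p * bool) : 'M[R[i]]_p := hpart (unit_mx k).

Lemma cr_unit_mx p (k l : 'I_p * 'I_p * bool) : cr k (unit_mx l) = (k == l)%:R.
Proof.
case: k l => [[i j] e] [[i' j'] e']; rewrite /cr /unit_mx !mxE/= !xpair_eqE.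
by case: ((i == i') && (j == j')); case: e; case: e';
  rewrite ?mulr0 ?mulr1 ?eqxx.
Qed.

Lemma hpart_sum p (A : 'M[R[i]]_p) :
  hpart A = \sum_k (cr k A)%:C *: hbasis k.
Proof.
apply: cr_inj => -[[i j] e]; rewrite cr_hpart cr_sum.
have E k : cr k A = \sum_l (cr l A) * (k == l)%:R.
  rewrite (bigD1 k)//= eqxx mulr1 big1 ?addr0// => l /negbTE lk.
  by rewrite eq_sym lk mulr0.
rewrite (E (i, j, e)) (E (j, i, e)) mulr_sumr -big_split mulr_sumr/=.
apply: eq_bigr => l _; rewrite crZ /hbasis cr_hpart !cr_unit_mx.
by move: (if e then -1 else 1) => s; ring.
Qed.

Lemma herm_linear_sum p q (f : 'M[R[i]]_p -> 'M[R[i]]_q) (I : finType)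
    (a : I -> R) (A : I -> 'M[R[i]]_p) : herm_linear f -> (forall i, herm (A i)) ->
  f (\sum_i (a i)%:C *: A i) = \sum_i (a i)%:C *: f (A i).
Proof.
move=> [hf lf] hA.
have f0 : f 0 = 0.
  have := lf 0 0 0 (herm0 p) (herm0 p).
  rewrite !scaler0 !addr0 => h.
  have := lf (-1) 0 0 (herm0 p) (herm0 p); rewrite scaler0 addr0 => ->.
  by apply: cr_inj => k; rewrite crD crZ cr0; ring.
suff [_ //] : herm (\sum_i (a i)%:C *: A i) /\
  f (\sum_i (a i)%:C *: A i) = \sum_i (a i)%:C *: f (A i).
rewrite !unlock; elim: (index_enum I) => [|i s [IH1 IH2]] /=.
  by split; [exact: herm0|].
split; first by apply: hermD IH1; exact: hermZ (hA i).
by rewrite (lf _ _ _ (hA i) IH1) IH2.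
Qed.

(** Only the values of f at Hermitian matrices are linear, hence the expansion in
Hermitian matrices rather than in matrix units. *)
Lemma herm_linearE p q (f : 'M[R[i]]_p -> 'M[R[i]]_q) (A : 'M[R[i]]_p) :
  herm_linear f -> herm A -> f A = \sum_k (cr k A)%:C *: f (hbasis k).
Proof.
move=> lf hA; rewrite -{1}(hpart_id hA) hpart_sum.
exact: (herm_linear_sum _ lf (fun k => herm_hpart _)).
Qed.

End HermitianBasis.

(** * Completions and the Riccati conditions *)
Section Blocks.
Context {R : realType} (n m : nat).
Local Notation E := (@Emx R n m).

Lemma ctr_col_mx p q r (A : 'M[R[i]]_(p, r)) (B : 'M[R[i]]_(q, r)) :
  (col_mx A B)^t* = row_mx (A^t*) (B^t*).
Proof. by rewrite tr_col_mx map_row_mx. Qed.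

Lemma ctr_row_mx p q r (A : 'M[R[i]]_(r, p)) (B : 'M[R[i]]_(r, q)) :
  (row_mx A B)^t* = col_mx (A^t*) (B^t*).
Proof. by rewrite tr_row_mx map_col_mx. Qed.

(** With W = 0 the completion is a congruence of Y, which makes it linear in Y
and positive semidefinite with Y. *)
Lemma completion_congr (Y : 'M[R[i]]_n) (K : 'M[R[i]]_(m, n)) :
  completion Y K 0 = col_mx 1%:M K *m Y *m (col_mx 1%:M K)^t*.
Proof.
rewrite /completion ctr_col_mx ctr1 mul_col_mx mul_col_row mul1mx !mulmx1.
by rewrite addr0.
Qed.

Lemma Emx_col (K : 'M[R[i]]_(m, n)) : E *m col_mx 1%:M K = 1%:M.
Proof. by rewrite /Emx mul_row_col mul1mx mul0mx addr0. Qed.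

Lemma Emx_completion (Y : 'M[R[i]]_n) (K : 'M[R[i]]_(m, n)) :
  E *m completion Y K 0 *m E^t* = Y.
Proof.
rewrite completion_congr !mulmxA Emx_col mul1mx -mulmxA -ctrM Emx_col ctr1.
by rewrite mulmx1.
Qed.

Lemma inner_Emx (P : 'M[R[i]]_n) (X : 'M[R[i]]_(n + m)) :
  inner (E^t* *m P *m E) X = inner P (E *m X *m E^t*).
Proof. by rewrite inner_congr. Qed.

Lemma psd_completion (Y : 'M[R[i]]_n) (K : 'M[R[i]]_(m, n)) :
  psd Y -> psd (completion Y K 0).
Proof. by move=> pY; rewrite completion_congr; exact: psd_congr. Qed.

Lemma herm_completion (Y : 'M[R[i]]_n) (K : 'M[R[i]]_(m, n)) :
  herm Y -> herm (completion Y K 0).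
Proof. by move=> pY; rewrite completion_congr; exact: herm_congr. Qed.

(** Minimizing the pairing of L with [I; K] Y [I; K]^* over K leads to
L3 K = - L2^*, and this is the solution of least norm when there is one. *)
Definition gain (L : 'M[R[i]]_(n + m)) : 'M[R[i]]_(m, n) :=
  - (mpinv (drsubmx L) *m (ursubmx L)^t*).

Section GRE.
Context (L : 'M[R[i]]_(n + m)) (hL : herm L) (gL : GRE L).
Let L1 := ulsubmx L.
Let L2 := ursubmx L.
Let L3 := drsubmx L.
Let K := gain L.

Let L_block : L = block_mx L1 L2 (L2^t*) L3.
Proof.
rewrite -[LHS]submxK; congr block_mx; have /hermP {1}<- := hL.
by rewrite -map_dlsubmx trmx_ursub.
Qed.

Let L3K : L3 *m K = - L2^t*.
Proof. by have [_ g _] := gL; rewrite /K /gain mulmxN mulmxA g. Qed.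

Let L2K : L2 *m K = - L1.
Proof.
by have [/eqP g _ _] := gL; rewrite /K /gain mulmxN mulmxA; move: g;
  rewrite subr_eq0 => /eqP <-.
Qed.

Let hL3 : L3^t* = L3.
Proof. by have [_ _ [/hermP]] := gL. Qed.

(** The lower block of L [I; K] vanishes by the range condition
L3 L3^+ L2^* = L2^*, the upper one by the vanishing of the Schur complement. *)
Lemma GRE_gain : L *m col_mx 1%:M K = 0.
Proof.
rewrite L_block mul_block_col !mulmx1 L2K L3K !subrr.
by rewrite col_mx0.
Qed.

(** As the Schur complement vanishes, completing the square leaves
L = [-K I]^* L3 [-K I]. *)
Lemma GRE_psd : psd L.
Proof.
(* only L3 K = - L2^* and L2 K = - L1 matter, and the block rewriting must not
   see the blocks of L inside K *)
move: L3K L2K; generalize K => k L3k L2k.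
have -> : L = (row_mx (- k) 1%:M)^t* *m L3 *m (row_mx (- k) 1%:M)^t*^t*.
  rewrite trmxCK ctr_row_mx ctrN ctr1 mul_col_mx mul_col_row.
  rewrite mul1mx mulmx1 !mulmxN !mulNmx opprK.
  have kL3 : k^t* *m L3 = - L2 by rewrite -{1}hL3 -ctrM L3k ctrN trmxCK.
  by rewrite kL3 L3k mulNmx L2k mulmx1 !opprK -L_block.
by apply: psd_congr; have [] := gL.
Qed.

Lemma GRE_inner (Y : 'M[R[i]]_n) : inner L (completion Y K 0) = 0.
Proof.
by rewrite completion_congr inner_congr -mulmxA GRE_gain mulmx0 inner0l.
Qed.

End GRE.

End Blocks.

(** * Square-integrable matrix functions *)
Section SquareIntegrable.
Context {R : realType}.
Local Notation mu := (@lebesgue_measure R).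
Implicit Types (a b : R) (f g : R -> R) (p q r : nat).

Definition L2 a b f : Prop :=
  measurable_fun `[a, b] f /\ L1 a b (fun t => f t ^+ 2).

Lemma L2M_L1 a b f g : L2 a b f -> L2 a b g -> L1 a b (fun t => f t * g t).
Proof.
move=> [mf f2] [mg g2]; apply: L1_le (L1D f2 g2); first exact: measurable_funM.
move=> t _; rewrite ler_norml.
have h1 := sqr_ge0 (f t + g t); have h2 := sqr_ge0 (f t - g t).
have h3 := sqr_ge0 (f t); have h4 := sqr_ge0 (g t).
by apply/andP; split; nra.
Qed.

Lemma L2D a b f g : L2 a b f -> L2 a b g -> L2 a b (fun t => f t + g t).
Proof.
move=> fL gL; have [mf f2] := fL; have [mg g2] := gL; split; first exact: measurable_funD.
have h := L1D (L1D f2 g2) (L1D (L2M_L1 fL gL) (L2M_L1 fL gL)).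
by apply: L1_eq h => t _; ring.
Qed.

Lemma L2M_bounded a b f g M : measurable_fun `[a, b] f ->
  (forall t, a <= t <= b -> `|f t| <= M) -> L2 a b g -> L2 a b (fun t => f t * g t).
Proof.
move=> mf fM [mg g2]; split; first exact: measurable_funM.
apply: (@L1_eq _ _ _ (fun t => f t ^+ 2 * g t ^+ 2)).
  by move=> t _; rewrite exprMn.
apply: (@L1M_bounded _ _ _ _ _ (M ^+ 2)) => //.
  exact: measurable_funX.
move=> t /fM fMt; rewrite normrX lerXn2r// ?nnegrE//.
exact: le_trans fMt.
Qed.

Lemma L2_cst a b (r : R) : L2 a b (cst r).
Proof.
split; first exact: measurable_cst.
exact: (@L1_cst _ a b (r ^+ 2)).
Qed.

Lemma L2_sum a b (I : finType) (f : I -> R -> R) :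
  (forall i, L2 a b (f i)) -> L2 a b (fun t => \sum_i f i t).
Proof.
move=> fi; rewrite unlock; elim: (index_enum I) => [|i s IH] /=.
  exact: L2_cst.
exact: L2D.
Qed.

Lemma L2_sub a b c d f : a <= c -> d <= b -> L2 a b f -> L2 c d f.
Proof.
move=> ac db [mf f2]; split; last exact: L1_sub f2.
apply: measurable_funS mf => //.
by apply: subset_itvScc => /=; rewrite bnd_simp.
Qed.

Lemma L2_eq a b f g : (forall t, a <= t <= b -> f t = g t) -> L2 a b f -> L2 a b g.
Proof.
move=> fg [mf f2]; split.
  apply: eq_measurable_fun mf => t; rewrite inE/= in_itv/= => tab.
  by rewrite fg.
by apply: L1_eq f2 => t tab; rewrite fg.
Qed.

Lemma mx_integrableP a b p q (A : R -> 'M[R[i]]_(p, q)) :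
  mx_integrable `[a, b] A <-> forall k, L1 a b (fun t => cr k (A t)).
Proof. exact: mx_allP. Qed.

Lemma mx_measurableP (D : set R) p q (A : R -> 'M[R[i]]_(p, q)) :
  mx_measurable D A <-> forall k, measurable_fun D (fun t => cr k (A t)).
Proof. exact: mx_allP. Qed.

Lemma mx_sq_integrableP a b p q (A : R -> 'M[R[i]]_(p, q)) :
  mx_sq_integrable `[a, b] A <-> forall k, L2 a b (fun t => cr k (A t)).
Proof.
rewrite /mx_sq_integrable mx_measurableP.
have := @mx_allP _ (fun f => mu.-integrable `[a, b] (fun t => (f t ^+ 2)%:E)) p q A.
move=> ->; split=> [[h1 h2] k|h]; first by split; [exact: h1|exact: h2].
by split=> k; have [] := h k.
Qed.

Definition mx_bounded a b (M : R) p q (A : R -> 'M[R[i]]_(p, q)) : Prop :=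
  forall k, measurable_fun `[a, b] (fun t => cr k (A t)) /\
            forall t, a <= t <= b -> `|cr k (A t)| <= M.

Lemma mx_measurableM (D : set R) p q r (A : R -> 'M[R[i]]_(p, q))
    (B : R -> 'M[R[i]]_(q, r)) : mx_measurable D A -> mx_measurable D B ->
  mx_measurable D (fun t => A t *m B t).
Proof.
move=> /mx_measurableP mA /mx_measurableP mB; apply/mx_measurableP => -[[i j] e].
rewrite (_ : (fun t => _) = fun t => \sum_l (cr (i, l, false) (A t) *
    cr (l, j, e) (B t) + (if e then 1 else -1) * (cr (i, l, true) (A t) *
    cr (l, j, ~~ e) (B t)))); last by apply/funext => t; rewrite cr_mul.
apply: measurable_sum => l; apply: measurable_funD; first exact: measurable_funM.
by apply: measurable_funM; [exact: measurable_cst|exact: measurable_funM].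
Qed.

Lemma mx_sq_integrableMr a b M p q r (A : R -> 'M[R[i]]_(p, q))
    (B : R -> 'M[R[i]]_(q, r)) : mx_sq_integrable `[a, b] A -> mx_bounded a b M B ->
  mx_sq_integrable `[a, b] (fun t => A t *m B t).
Proof.
move=> /mx_sq_integrableP AL BM; apply/mx_sq_integrableP => -[[i j] e].
rewrite (_ : (fun t => _) = fun t => \sum_l (cr (l, j, e) (B t) * cr (i, l, false) (A t)
    + (if e then 1 else -1) * (cr (l, j, ~~ e) (B t) * cr (i, l, true) (A t)))); last first.
  by apply/funext => t; rewrite cr_mul; apply: eq_bigr => l _; congr (_ + _ * _); rewrite mulrC.
apply: L2_sum => l; apply: L2D.
  by have [m1 m2] := BM (l, j, e); exact: L2M_bounded m1 m2 _.
have [m1 m2] := BM (l, j, ~~ e).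
have h := L2M_bounded m1 m2 (AL (i, l, true)).
apply: (@L2M_bounded _ _ _ _ 1) h => // t _.
by case: (e); rewrite ?normrN normr1.
Qed.

Lemma mx_integrableM a b p q r (A : R -> 'M[R[i]]_(p, q)) (B : R -> 'M[R[i]]_(q, r)) :
  mx_sq_integrable `[a, b] A -> mx_sq_integrable `[a, b] B ->
  mx_integrable `[a, b] (fun t => A t *m B t).
Proof.
move=> /mx_sq_integrableP AL /mx_sq_integrableP BL; apply/mx_integrableP => -[[i j] e].
apply: (@L1_eq _ _ _ (fun t => \sum_l (cr (i, l, false) (A t) *
    cr (l, j, e) (B t) + (if e then 1 else -1) * (cr (i, l, true) (A t) *
    cr (l, j, ~~ e) (B t))))); first by move=> t _; rewrite cr_mul.
by apply: L1_sum => l; apply: L1D; [|apply: L1Z]; exact: L2M_L1.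
Qed.

Lemma mx_sq_integrable_ctr a b p q (A : R -> 'M[R[i]]_(p, q)) :
  mx_sq_integrable `[a, b] A -> mx_sq_integrable `[a, b] (fun t => (A t)^t*).
Proof.
move=> /mx_sq_integrableP AL; apply/mx_sq_integrableP => -[[i j] e].
apply: (@L2_eq _ _ (fun t => (if e then -1 else 1) * cr (j, i, e) (A t))).
  by move=> t _; rewrite cr_ctr.
apply: (@L2M_bounded _ _ _ _ 1) => // t _.
by case: (e); rewrite ?normrN normr1.
Qed.

Lemma mx_measurable_ctr (D : set R) p q (A : R -> 'M[R[i]]_(p, q)) :
  mx_measurable D A -> mx_measurable D (fun t => (A t)^t*).
Proof.
move=> /mx_measurableP AL; apply/mx_measurableP => -[[i j] e].
rewrite (_ : (fun t => _) = fun t => (if e then -1 else 1) * cr (j, i, e) (A t)).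
  by apply: measurable_funM => //; exact: measurable_cst.
by apply/funext => t; rewrite cr_ctr.
Qed.

Lemma cr_col_mx p q r (A : 'M[R[i]]_(p, r)) (B : 'M[R[i]]_(q, r)) i j e :
  cr (i, j, e) (col_mx A B) = match fintype.split i with
    inl i1 => cr (i1, j, e) A | inr i2 => cr (i2, j, e) B end.
Proof. by rewrite /cr/= mxE; case: fintype.split. Qed.

Lemma mx_sq_integrable_col a b n m (K : R -> 'M[R[i]]_(m, n)) :
  mx_sq_integrable `[a, b] K ->
  mx_sq_integrable `[a, b] (fun t => col_mx (1%:M : 'M[R[i]]_n) (K t)).
Proof.
move=> /mx_sq_integrableP KL; apply/mx_sq_integrableP => -[[i j] e].
apply: (@L2_eq _ _ (fun t => match fintype.split i with
    inl i1 => cr (i1, j, e) 1%:M | inr i2 => cr (i2, j, e) (K t) end)).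
  by move=> t _; rewrite cr_col_mx.
by case: (fintype.split i) => k; [exact: L2_cst|exact: KL].
Qed.

Lemma mx_measurable_col (D : set R) n m (K : R -> 'M[R[i]]_(m, n)) :
  mx_measurable D K -> mx_measurable D (fun t => col_mx (1%:M : 'M[R[i]]_n) (K t)).
Proof.
move=> /mx_measurableP KL; apply/mx_measurableP => -[[i j] e].
rewrite (_ : (fun t => _) = fun t => match fintype.split i with
    inl i1 => cr (i1, j, e) 1%:M | inr i2 => cr (i2, j, e) (K t) end).
  by case: (fintype.split i) => k; [exact: measurable_cst|exact: KL].
by apply/funext => t; rewrite cr_col_mx.
Qed.

(** Completions are quadratic in K, so a square-integrable gain and a bounded
state give an integrable one. *)
Lemma completion_integrable a b M n m (K : R -> 'M[R[i]]_(m, n)) (Y : R -> 'M[R[i]]_n) :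
  mx_sq_integrable `[a, b] K -> mx_bounded a b M Y ->
  mx_integrable `[a, b] (fun t => completion (Y t) (K t) 0).
Proof.
move=> /mx_sq_integrable_col KL YM.
rewrite (_ : (fun t => _) = fun t =>
  col_mx 1%:M (K t) *m Y t *m (col_mx 1%:M (K t))^t*); last first.
  by apply/funext => t; rewrite completion_congr.
apply: mx_integrableM; last exact: mx_sq_integrable_ctr.
exact: mx_sq_integrableMr YM.
Qed.

Lemma completion_measurable (D : set R) n m (K : R -> 'M[R[i]]_(m, n))
    (Y : R -> 'M[R[i]]_n) : mx_measurable D K -> mx_measurable D Y ->
  mx_measurable D (fun t => completion (Y t) (K t) 0).
Proof.
move=> /mx_measurable_col KL YM.
rewrite (_ : (fun t => _) = fun t =>
  col_mx 1%:M (K t) *m Y t *m (col_mx 1%:M (K t))^t*); last first.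
  by apply/funext => t; rewrite completion_congr.
apply: mx_measurableM; last exact: mx_measurable_ctr.
exact: mx_measurableM.
Qed.

Lemma cvg_completion (G : set_system R) {FG : Filter G} n m (K : 'M[R[i]]_(m, n))
    (Y : R -> 'M[R[i]]_n) Y0 :
  mx_cvg G Y Y0 -> mx_cvg G (fun t => completion (Y t) K 0) (completion Y0 K 0).
Proof.
move=> cY; rewrite completion_congr.
rewrite (_ : (fun t => _) = fun t =>
  col_mx 1%:M K *m Y t *m (col_mx 1%:M K)^t*); last first.
  by apply/funext => t; rewrite completion_congr.
apply: mx_cvgM; last exact: mx_cvg_cst.
by apply: mx_cvgM => //; exact: mx_cvg_cst.
Qed.

Lemma completion_sum n m (K : 'M[R[i]]_(m, n)) (I : finType) (a : I -> R)
    (Y : I -> 'M[R[i]]_n) :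
  completion (\sum_i (a i)%:C *: Y i) K 0 = \sum_i (a i)%:C *: completion (Y i) K 0.
Proof.
rewrite completion_congr mulmx_sumr mulmx_suml; apply: eq_bigr => i _.
by rewrite completion_congr -scalemxAr -scalemxAl.
Qed.

End SquareIntegrable.

(** * Closed-loop dynamics *)
Lemma within_measurable {R : realType} (c d : R) (f : R -> R) :
  {within `[c, d], continuous f} -> measurable_fun `[c, d] f.
Proof. by apply: subspace_continuous_measurable_fun. Qed.

Lemma within_bounded {R : realType} (c d : R) (f : R -> R) : c <= d ->
  {within `[c, d], continuous f} -> exists M : R, forall t, c <= t <= d -> `|f t| <= M.
Proof.
move=> cd cf.
have [u _ Hu] := EVT_max cd cf; have [v _ Hv] := EVT_min cd cf.
exists (Num.max `|f u| `|f v|) => t tcd.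
have tin : t \in `[c, d] by rewrite in_itv.
rewrite le_max !ler_norml.
have h1 := Hu t tin; have h2 := Hv t tin.
have h3 := ler_norm (f u); have h4 := ler_norm (- f v); rewrite normrN in h4.
have [h|h] := leP 0 (f t); apply/orP; [left|right]; apply/andP; split; lra.
Qed.

Section StateOperator.
Context {R : realType} (n m : nat) (S : impulsive_system R n m).
Context (c d : R) (t0c : t0 S <= c) (cd : c <= d).

Let F_basis_continuous k l :
  {within `[c, d], continuous (fun t => cr k (F S t (hbasis l)))}.
Proof.
apply/subspace_continuousP => t; rewrite /= in_itv/= => /andP[ct td].
have t0t := le_trans t0c ct.
have /mx_cvgP/(_ k) := F_continuous (herm_hpart (unit_mx l)) t0t.
apply: cvg_trans; apply: cvg_app; apply: within_subset.
by move=> s /=; rewrite in_itv/= => /andP[cs _]; exact: le_trans cs.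
Qed.

Let F_basis_measurable k l :
  measurable_fun `[c, d] (fun t => cr k (F S t (hbasis l))).
Proof. by apply: within_measurable; exact: F_basis_continuous. Qed.

(** F t is a combination, with coefficients linear in X t, of its values at the
spanning family, and these are continuous in t, hence bounded on [c, d]. *)
Lemma F_integrable (X : R -> 'M[R[i]]_(n + m)) :
  (forall t, c <= t <= d -> herm (X t)) -> mx_integrable `[c, d] X ->
  mx_integrable `[c, d] (fun t => F S t (X t)).
Proof.
move=> hX /mx_integrableP X1; apply/mx_integrableP => k.
apply: (@L1_eq _ _ _ (fun t => \sum_l cr k (F S t (hbasis l)) * cr l (X t))).
  move=> t tcd; have /andP[ct td] := tcd.
  rewrite (herm_linearE (@F_linear _ _ _ S t (le_trans t0c ct)) (hX t tcd)) cr_sum.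
  by apply: eq_bigr => l _; rewrite crZ mulrC.
apply: L1_sum => l; have [M HM] := within_bounded cd (@F_basis_continuous k l).
exact: (L1M_bounded (F_basis_measurable k l) HM).
Qed.

Lemma F_completionE (Y : 'M[R[i]]_n) (K : 'M[R[i]]_(m, n)) k t : t0 S <= t ->
  herm Y -> cr k (F S t (completion Y K 0)) =
  \sum_l cr k (F S t (completion (hbasis l) K 0)) * cr l Y.
Proof.
move=> t0t hY; rewrite -{1}(hpart_id hY) hpart_sum completion_sum.
rewrite herm_linear_sum; [|exact: F_linear|]; last first.
  by move=> l; apply: herm_completion; exact: herm_hpart.
by rewrite cr_sum; apply: eq_bigr => l _; rewrite crZ mulrC.
Qed.

(** For a fixed gain, the closed loop Y' = F(t, [I; K] Y [I; K]^* ) reads in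
coordinates as a linear system with this matrix, quadratic in K. *)
Definition closed_loop_coef (K : R -> 'M[R[i]]_(m, n)) k l t : R :=
  cr k (F S t (completion (hbasis l) (K t) 0)).

(** The solution of the coordinate system is Hermitian because the coefficients
have the Hermitian symmetry in their first index, and then it is positive
semidefinite because the flow preserves the cone. The bound on Y depends on the
gain only through kap, so it is the same for all gains whose coefficients kap
dominates. *)
Lemma closed_loop_coef_L1 (K : R -> 'M[R[i]]_(m, n)) k l :
  mx_sq_integrable `[c, d] K -> L1 c d (closed_loop_coef K k l).
Proof.
move=> KL.
have : mx_integrable `[c, d] (fun t => F S t (completion (hbasis l) (K t) 0)).
  apply: F_integrable => [t _|]; first by apply: herm_completion; exact: herm_hpart.
  apply: (@completion_integrable _ _ _ (\sum_j `|cr j (@hbasis R n l)|)) => // j.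
  split; first exact: measurable_cst.
  by move=> t _; rewrite (bigD1 j)//= lerDl sumr_ge0.
by move=> /mx_integrableP; exact.
Qed.

Lemma closed_loop (K : R -> 'M[R[i]]_(m, n)) (Y0 : 'M[R[i]]_n) (kap : R -> R) :
  mx_sq_integrable `[c, d] K -> psd Y0 -> L1 c d kap ->
  (forall k t, c <= t <= d -> \sum_l `|closed_loop_coef K k l t| <= kap t) ->
  (forall t, c <= t <= d -> 0 <= kap t) ->
  exists Y : R -> 'M[R[i]]_n, [/\ Y c = Y0,
    forall k, primitive c d (fun t => cr k (Y t))
                (fun t => cr k (F S t (completion (Y t) (K t) 0))),
    mx_bounded c d ((\sum_k `|cr k Y0|) * expR (integ c d kap)) Y &
    forall t, c <= t <= d -> psd (Y t)].
Proof.
move=> KL pY0 kap1 Kkap kap0.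
have Y0B k : `|cr k Y0| <= \sum_k `|cr k Y0| by rewrite (bigD1 k)//= lerDl sumr_ge0.
have [y Hy] := linear_ode cd (fun k l => closed_loop_coef_L1 k l KL) kap1 kap0 Kkap Y0B.
pose Y t : 'M[R[i]]_n := \matrix_(i, j) (y (i, j, false) t +i* y (i, j, true) t).
have crY k t : cr k (Y t) = y k t by case: k => -[i j] []; rewrite /cr/= mxE.
have t0t t : c <= t -> t0 S <= t by exact: le_trans.
have hY t : c <= t <= d -> herm (Y t).
  move=> /andP[ct td]; apply/herm_cr => i j e; rewrite !crY.
  have [[_ p1] i1 _] := Hy (i, j, e); have [[l2 p2] i2 _] := Hy (j, i, e).
  rewrite p1 ?ct// p2 ?ct// i1 i2 mulrDr.
  have /herm_cr -> : herm Y0 by case: pY0.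
  congr (_ + _); rewrite -integZ; last exact: L1_sub l2.
  apply: integ_eq => s /andP[cs _]; rewrite mulr_sumr; apply: eq_bigr => l _.
  have /herm_cr h : herm (F S s (completion (hbasis l) (K s) 0)).
    have [+ _] := @F_linear _ _ _ S s (t0t s cs); apply.
    by apply: herm_completion; exact: herm_hpart.
  by rewrite /closed_loop_coef h mulrA.
have Yc : Y c = Y0 by apply: cr_inj => k; rewrite crY; have [_ ->] := Hy k.
have prim k : primitive c d (fun t => cr k (Y t))
                (fun t => cr k (F S t (completion (Y t) (K t) 0))).
  have [pk _ _] := Hy k.
  apply: primitive_eq pk => // t tcd.
  rewrite F_completionE; [|by apply: t0t; case/andP: tcd|exact: hY].
  by apply: eq_bigr => l _; rewrite crY.
exists Y; split => //.
- move=> k; split; first exact: primitive_measurable (prim k).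
  by move=> t tcd; rewrite crY; have [_ _] := Hy k; exact.
- move=> t tcd.
  apply: (@F_psd _ _ _ S c d Y K (fun=> 0)) => //.
  + by apply/mx_integrableP => k; rewrite cr0; exact: L1_cst.
  + by move=> *; exact: psd0.
  + by apply/mx_integrableP => k; have [] := prim k.
  + move=> s scd; apply: cr_inj => k; rewrite crD cr_op.
    by have [_ ->] := prim k.
  + by rewrite Yc.
Qed.

End StateOperator.

(** * One-sided limits and piecewise C1 multipliers *)
Lemma count_lt (T : eqType) (p q : pred T) s r : (forall x, p x -> q x) ->
  r \in s -> q r -> ~~ p r -> (count p s < count q s)%N.
Proof.
move=> pq + qr pr; elim: s => //= x s IH; rewrite in_cons => /predU1P[<-|/IH].
  by rewrite qr (negbTE pr) add0n add1n ltnS; exact: sub_count.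
rewrite -addnS; apply: leq_add.
by case px : (p x) => //; rewrite (pq _ px).
Qed.

Lemma away_from_seq {R : realType} (s : seq R) (t : R) : t \notin s ->
  exists2 e : R, 0 < e & forall r, r \in s -> ~ (t - e < r < t + e).
Proof.
elim: s => [|x s IH]; first by exists 1.
rewrite in_cons negb_or => /andP[tx /IH[e e0 He]].
have xt : 0 < `|t - x| by rewrite normr_gt0 subr_eq0.
exists (Num.min e `|t - x|); first by rewrite lt_min e0.
move=> r; rewrite in_cons => /predU1P[->|rs] /andP[h1 h2].
  have h : `|t - x| < Num.min e `|t - x|.
    by rewrite ltr_norml; apply/andP; split; lra.
  by move: h; rewrite lt_min ltxx andbF.
have h3 : Num.min e `|t - x| <= e by rewrite ge_min lexx.
by apply: (He r rs); apply/andP; split; lra.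
Qed.

Section OneSidedLimits.
Context {R : realType}.
Implicit Types (p q : nat) (c d t : R).

Lemma near_right_oo c d : c < d -> \forall t \near c^'+, c < t < d.
Proof.
move=> cd; near=> t; apply/andP; split; near: t.
  exact: nbhs_right_gt.
exact: nbhs_right_lt.
Unshelve. all: by end_near. Qed.

Lemma near_left_oo c d : c < d -> \forall t \near d^'-, c < t < d.
Proof.
move=> cd; near=> t; apply/andP; split; near: t.
  exact: nbhs_left_gt.
exact: nbhs_left_lt.
Unshelve. all: by end_near. Qed.

Lemma left_limE p q (A : R -> 'M[R[i]]_(p, q)) t B :
  mx_cvg t^'- A B -> left_lim A t = B.
Proof.
by move=> /mx_cvgP AB; apply: cr_inj => k; rewrite cr_op; apply: cvg_lim.
Qed.

Lemma right_limE p q (A : R -> 'M[R[i]]_(p, q)) t B :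
  mx_cvg t^'+ A B -> right_lim A t = B.
Proof.
by move=> /mx_cvgP AB; apply: cr_inj => k; rewrite cr_op; apply: cvg_lim.
Qed.

Lemma mx_cvg_near (G : set_system R) {FG : Filter G} p q (A B : R -> 'M[R[i]]_(p, q)) A0 :
  (\forall t \near G, A t = B t) -> mx_cvg G A A0 -> mx_cvg G B A0.
Proof.
move=> AB /mx_cvgP cA; apply/mx_cvgP => k.
apply: cvg_trans (cA k); apply: near_eq_cvg.
by apply: filterS AB => t ->.
Qed.

Lemma mx_cvg_sub (G G' : set_system R) p q (A : R -> 'M[R[i]]_(p, q)) B :
  (forall U, G U -> G' U) -> mx_cvg G A B -> mx_cvg G' A B.
Proof.
move=> GG /mx_cvgP cA; apply/mx_cvgP => k.
by apply: cvg_trans (cA k) => U; exact: GG.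
Qed.

Lemma mx_cvg_within_right p q (A : R -> 'M[R[i]]_(p, q)) c a b B : c < b -> a <= c ->
  mx_cvg (within `[a, b] (nbhs c)) A B -> mx_cvg c^'+ A B.
Proof.
move=> cb ac; apply: mx_cvg_sub => U h.
have h2 : \forall s \near c, s < b by exact: lt_nbhsl.
apply: (@filterS2 _ (nbhs c) _ _ _ (fun u => c < u -> U u) _ h h2) => s hs sb cs.
apply: hs => /=.
by rewrite in_itv/= (ltW sb) (le_trans ac (ltW cs)).
Qed.

Lemma mx_cvg_within_left p q (A : R -> 'M[R[i]]_(p, q)) c a b B : a < c -> c <= b ->
  mx_cvg (within `[a, b] (nbhs c)) A B -> mx_cvg c^'- A B.
Proof.
move=> ac cb; apply: mx_cvg_sub => U h.
have h2 : \forall s \near c, a < s by exact: lt_nbhsr.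
apply: (@filterS2 _ (nbhs c) _ _ _ (fun u => u < c -> U u) _ h h2) => s hs as_ sc.
apply: hs => /=.
by rewrite in_itv/= (ltW as_) (le_trans (ltW sc) cb).
Qed.

Lemma primitive_C1 c d (f : R -> R) : c <= d -> (forall t, derivable f t 1) ->
  continuous (derive1 f) -> primitive c d f (derive1 f).
Proof.
move=> cd df cf; split.
  apply: continuous_compact_integrable; first exact: segment_compact.
  exact: continuous_subspaceT.
have fc : continuous f.
  by move=> t; apply: differentiable_continuous; apply/derivable1_diffP.
move=> t /andP[ct td]; move: ct; rewrite le_eqVlt => /predU1P[<-|ct].
  by rewrite integ_pt addr0.
have := @continuous_FTC2 _ (derive1 f) f c t ct.
rewrite /integ /Rintegral => ->.
- by rewrite /=; ring.
- exact: continuous_subspaceT.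
- split; first by move=> x _; exact: df.
  + exact/cvg_at_right_filter/fc.
  + exact/cvg_at_left_filter/fc.
- by [].
Qed.

Lemma primitive_glue c d r (p q : R -> R) : c <= r -> r <= d ->
  primitive c r p q -> primitive r d p q -> primitive c d p q.
Proof.
move=> cr rd [q1 p1] [q2 p2]; have q3 := L1_glue cr rd q1 q2; split=> // t /andP[ct td].
have [tr|rt] := leP t r; first by rewrite p1 ?ct.
rewrite p2 ?(ltW rt)// (p1 r) ?cr ?lexx//.
rewrite (@integ_split _ c t r)// ?(ltW rt)//; first by ring.
exact: L1_sub q3.
Qed.

Lemma primitive_cvg_right c d (p q : R -> R) : c < d -> primitive c d p q ->
  p t @[t --> c^'+] --> p c.
Proof.
move=> cd pq.
by have [] := (continuous_within_itvP p cd).1 (primitive_continuous (ltW cd) pq).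
Qed.

Lemma primitive_cvg_left c d (p q : R -> R) : c < d -> primitive c d p q ->
  p t @[t --> d^'-] --> p d.
Proof.
move=> cd pq.
by have [] := (continuous_within_itvP p cd).1 (primitive_continuous (ltW cd) pq).
Qed.

End OneSidedLimits.

Section PiecewiseC1.
Context {R : realType} (n m : nat) (S : impulsive_system R n m) (T : R)
  (C : horizon_cost S T) (P : R -> 'M[R[i]]_n) (hP : piecewise_C1 C P).
Local Notation mu := (@lebesgue_measure R).
Local Notation t0 := (t0 S).
Local Notation t1 := (t0 + T).
Local Notation tj := (jump_time S).

Definition jump_free (c d : R) : Prop :=
  forall k, (k < NT C)%N -> ~ (c < tj k < d).

(** The value of P at a jump time carries no information; on a piece between
jumps it is this modification that is continuous up to both ends. *)
Definition with_ends (A : R -> 'M[R[i]]_n) (c d t : R) : 'M[R[i]]_n :=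
  if t <= c then right_lim A c else if t < d then A t else left_lim A d.

Lemma with_ends_in (A : R -> 'M[R[i]]_n) c d t : c < t < d -> with_ends A c d t = A t.
Proof. by move=> /andP[ct td]; rewrite /with_ends leNgt ct td. Qed.

Lemma with_ends_l (A : R -> 'M[R[i]]_n) c d : with_ends A c d c = right_lim A c.
Proof. by rewrite /with_ends lexx. Qed.

Lemma with_ends_r (A : R -> 'M[R[i]]_n) c d : c < d -> with_ends A c d d = left_lim A d.
Proof. by move=> cd; rewrite /with_ends leNgt cd ltxx. Qed.

Let derive_eq k (A B : R -> 'M[R[i]]_n) c d t :
  (forall t, c < t < d -> A t = B t) -> c < t < d ->
  cr k (mx_deriv A t) = derive1 (fun t => cr k (B t)) t.
Proof.
move=> AB tcd; rewrite cr_op !derive1E; apply: near_eq_derive.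
have tin : t \in `]c, d[ by rewrite in_itv.
apply: filterS (near_in_itvoo tin) => s; rewrite in_itv/= => scd.
by rewrite AB.
Qed.

Let piece_lim c d Q : c < d -> mx_C1 Q -> (forall t, c < t < d -> P t = Q t) ->
  mx_cvg c^'+ P (Q c) /\ mx_cvg d^'- P (Q d).
Proof.
move=> cd /mx_allP Q1 PQ.
have cQ k : continuous (fun t => cr k (Q t)).
  by move=> t; apply: differentiable_continuous; apply/derivable1_diffP; exact: (Q1 k).1.
split.
- apply: (@mx_cvg_near _ c^'+ _ _ _ Q).
    by apply: filterS (near_right_oo cd) => t /PQ.
  by apply/mx_cvgP => k; apply/cvg_at_right_filter/cQ.
- apply: (@mx_cvg_near _ d^'- _ _ _ Q).
    by apply: filterS (near_left_oo cd) => t /PQ.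
  by apply/mx_cvgP => k; apply/cvg_at_left_filter/cQ.
Qed.

Let piece_primitive c d Q k : c < d -> mx_C1 Q -> (forall t, c < t < d -> P t = Q t) ->
  primitive c d (fun t => cr k (with_ends P c d t)) (fun t => cr k (mx_deriv P t)).
Proof.
move=> cd Q1 PQ; have [cQ dQ] := piece_lim cd Q1 PQ.
move/mx_allP : Q1 => Q1; have [dQk cQk] := Q1 k.
have [q1 qi] := primitive_C1 (ltW cd) dQk cQk.
have wQ t : c <= t <= d -> with_ends P c d t = Q t.
  rewrite /with_ends => /andP[ct td]; case: ifPn => tc.
    by rewrite (right_limE cQ); congr Q; apply/le_anti; rewrite ct tc.
  case: ifPn => td'; first by rewrite PQ// td' ltNge tc.
  by rewrite (left_limE dQ); congr Q; apply/le_anti; rewrite td leNgt td'.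
have dPQ t : c < t < d -> derive1 (fun t => cr k (Q t)) t = cr k (mx_deriv P t).
  by move=> tcd; rewrite (derive_eq k PQ tcd).
split; first by have [] := L1_oo (ltW cd) dPQ q1.
move=> t /andP[ct td]; rewrite !wQ ?lexx ?(ltW cd) ?ct// qi ?ct//; congr (_ + _).
have [] := @L1_oo _ c t _ (fun t => cr k (mx_deriv P t)) ct _ (L1_sub _ _ q1) => //.
by move=> s /andP[cs st]; apply: dPQ; rewrite cs (lt_le_trans st).
Qed.

Lemma pwC1_right c : t0 <= c < t1 -> (forall k, (k < NT C)%N -> c <> tj k) ->
  mx_cvg c^'+ P (P c).
Proof.
move=> /andP[t0c ct1] cj; apply: (@mx_cvg_within_right _ _ _ _ _ t0 t1) => //.
by apply: (pwC1_continuous hP) => //; rewrite t0c ltW.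
Qed.

Lemma pwC1_left c : t0 < c <= t1 -> (forall k, (k < NT C)%N -> c <> tj k) ->
  mx_cvg c^'- P (P c).
Proof.
move=> /andP[t0c ct1] cj; apply: (@mx_cvg_within_left _ _ _ _ _ t0 t1) => //.
by apply: (pwC1_continuous hP) => //; rewrite ct1 ltW.
Qed.

(** By induction on the number of breakpoints inside ]c, d[. Without any, P is C1
up to the boundary. A breakpoint r inside is not a jump time, so P is continuous
there and the primitives on [c, r] and [r, d] agree at r. *)
Lemma pwC1_primitive c d : t0 <= c -> c < d -> d <= t1 -> jump_free c d ->
  [/\ mx_cvg c^'+ P (right_lim P c), mx_cvg d^'- P (left_lim P d) &
   forall k, primitive c d (fun t => cr k (with_ends P c d t))
                            (fun t => cr k (mx_deriv P t))].
Proof.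
have [s Hs] := pwC1_pieces hP.
pose inside c d := [seq r <- s | c < r < d].
move sz : (size (inside c d)) => N; have {sz} : (size (inside c d) <= N)%N by rewrite sz.
elim: N c d => [|N IH] c d sz t0c cd dt1 jf.
  have [|Q Q1 PQ] := Hs c d t0c cd dt1.
    move=> r rs rcd; have : r \in inside c d by rewrite mem_filter rcd.
    by move: sz; rewrite leqn0 => /nilP ->.
  have [cQ dQ] := piece_lim cd Q1 PQ.
  split; [by rewrite (right_limE cQ)|by rewrite (left_limE dQ)|].
  by move=> k; exact: (piece_primitive _ cd Q1 PQ).
have [szN|] := leqP (size (inside c d)) N; first exact: IH.
move=> szN; have [r rs] : exists r, r \in inside c d.
  by case: (inside c d) szN => // r l _; exists r; rewrite mem_head.
move: (rs); rewrite mem_filter => /andP[/andP[cr_ rd] _].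
have lt_count a b : c <= a -> b <= d -> ~~ (a < r < b) -> (size (inside a b) <= N)%N.
  move=> ca bd rab; rewrite -ltnS; apply: leq_trans sz.
  rewrite /inside !size_filter; apply: (@count_lt _ _ _ _ r) => //; last first.
  - by rewrite cr_.
  - by move: rs; rewrite mem_filter => /andP[].
  - by move=> x /andP[ax xb]; rewrite (le_lt_trans ca ax) (lt_le_trans xb).
have rj k : (k < NT C)%N -> r <> tj k.
  by move=> kN rk; apply: (jf k kN); rewrite -rk cr_.
have rt1 : r < t1 by exact: lt_le_trans dt1.
have t0r : t0 < r by exact: le_lt_trans cr_.
have [||c1 _ p1] := IH c r _ t0c cr_ (ltW rt1).
- by apply: lt_count => //; [exact: ltW|rewrite ltxx andbF].
- by move=> k kN /andP[ck kr]; apply: (jf k kN); rewrite ck (lt_trans kr).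
have [||_ c2 p2] := IH r d _ (ltW t0r) rd dt1.
- by apply: lt_count => //; [exact: ltW|rewrite ltxx].
- by move=> k kN /andP[ck kr]; apply: (jf k kN); rewrite kr (lt_trans _ ck).
split; [exact: c1|exact: c2|move=> k].
apply: (primitive_glue (ltW cr_) (ltW rd)).
- apply: (primitive_eq _ (fun t _ => erefl) (ltW cr_) (p1 k)) => t /andP[ct tr].
  congr cr; rewrite /with_ends; case: ifP => [_|_]; first exact: erefl.
  rewrite (le_lt_trans tr rd); move: tr; rewrite le_eqVlt => /predU1P[->|->].
    have t0r1 : t0 < r <= t1 by rewrite t0r ltW.
    by rewrite ltxx (left_limE (pwC1_left t0r1 rj)).
  exact: erefl.
- apply: (primitive_eq _ (fun t _ => erefl) (ltW rd) (p2 k)) => t /andP[rt td].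
  congr cr; rewrite /with_ends [in RHS]leNgt (lt_le_trans cr_ rt)/=.
  move: rt; rewrite le_eqVlt => /predU1P[<-|rt]; last first.
    by rewrite leNgt rt; exact: erefl.
  have t0r1 : t0 <= r < t1 by rewrite rt1 ltW.
  by rewrite lexx rd (right_limE (pwC1_right t0r1 rj)).
Qed.

(** Away from t0, t1 and the finitely many breakpoints P is locally C1, and its
derivative inherits the symmetry of P. *)
Lemma pwC1_deriv_herm :
  {ae mu, forall t, `[t0, t1]%classic t -> herm (mx_deriv P t)}.
Proof.
have [s Hs] := pwC1_pieces hP.
have cN : countable [set` [:: t0, t1 & s]] by exact: finite_set_countable.
have N0 : mu [set` [:: t0, t1 & s]] = 0%E by exact: countable_lebesgue_measure0.
exists [set` [:: t0, t1 & s]]; split => //.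
  apply: countable_measurable => [x|]; first exact: measurable_set1.
  exact: cN.
move=> t /= /not_implyP[]; rewrite in_itv/= => /andP[t0t tt1] nh.
apply: contrapT => /negP; rewrite !in_cons !negb_or => /and3P[tt0 tt1' ts]; apply: nh.
have {tt0} t0t : t0 < t by rewrite lt_neqAle eq_sym tt0.
have {tt1'} tt1 : t < t1 by rewrite lt_neqAle tt1'.
have [e e0 He] := away_from_seq ts.
pose a := Num.max t0 (t - e); pose b := Num.min t1 (t + e).
have tab : a < t < b by rewrite gt_max lt_min t0t tt1 gtrBl ltrDl e0.
have [at_ tb] := andP tab.
have ta0 : t0 <= a by rewrite le_max lexx.
have bt1 : b <= t1 by rewrite ge_min lexx.
have [|Q /mx_allP Q1 PQ] := Hs a b ta0 (lt_trans at_ tb) bt1.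
  move=> r /He H /andP[ar rb]; apply: H.
  by move: ar rb; rewrite gt_max lt_min => /andP[_ ->] /andP[_ ->].
apply/herm_cr => i j f; rewrite !(derive_eq _ PQ tab) !derive1E.
have near_Q : \forall u \near t, cr (i, j, f) (Q u) =
    (if f then -1 else 1) * cr (j, i, f) (Q u).
  have tin : t \in `]a, b[ by rewrite in_itv.
  apply: filterS (near_in_itvoo tin) => u; rewrite in_itv/= => uab.
  have /herm_cr : herm (P u).
    case/andP: uab => au ub; apply: (pwC1_herm hP).
    by rewrite (le_trans ta0 (ltW au)) (le_trans (ltW ub)).
  by rewrite PQ.
rewrite (near_eq_derive _ near_Q); case: (f).
  rewrite mulN1r -deriveN; last exact: (Q1 _).1.
  by congr ('D_1 _ t); apply/funext => u; rewrite mulN1r.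
by rewrite mul1r; congr ('D_1 _ t); apply/funext => u; rewrite mul1r.
Qed.

End PiecewiseC1.

(** * The energy identity and weak duality *)
Section Arithmetic.
Context {R : realType}.

Lemma subr_swap (a b c d : R) : a - b = c - d -> a - c = b - d.
Proof. by move=> h; lra. Qed.

Lemma energy_step (i i' sz z r r' l p ic sd : R) :
  i + sz + r = p + ic + sd ->
  i + i' + (sz + z) + r' = p + (ic + (i' + l - r)) + (sd + (r' - l + z)).
Proof. by move=> h; lra. Qed.

Lemma energy_last_step (i i' sz z r l p ic sd : R) :
  i + sz + r = p + ic + sd ->
  i + i' + (sz + z) = p + (ic + (i' + l - r)) + sd + (z - l).
Proof. by move=> h; lra. Qed.

Lemma energy_lower_bound (cx z l r e : R) :
  cx = z + l - r -> 0 <= z -> 0 <= l -> cx <= e -> 0 <= e + r.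
Proof. by move=> *; lra. Qed.

Lemma jump_lower_bound (r l z : R) : r - l + z = 0 -> 0 <= r -> 0 <= z -> 0 <= l.
Proof. by move=> *; lra. Qed.

End Arithmetic.

Section Energy.
Context {R : realType} (n m : nat) (S : impulsive_system R n m) (T : R)
  (hT : 0 < T) (C : horizon_cost S T) (P : R -> 'M[R[i]]_n) (hP : piecewise_C1 C P).
Local Notation mu := (@lebesgue_measure R).
Local Notation E := (@Emx R n m).
Local Notation t0 := (t0 S).
Local Notation t1 := (t0 + T).
Local Notation tj := (jump_time S).

Lemma lim_herm_right c d : t0 <= c -> c < d -> d <= t1 -> jump_free C c d ->
  herm (right_lim P c).
Proof.
move=> t0c cd dt1 jf; have [cP _ _] := pwC1_primitive hP t0c cd dt1 jf.
apply: (herm_lim cP); apply: filterS (near_right_oo cd) => t /andP[ct td].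
by apply: (pwC1_herm hP); rewrite (le_trans t0c (ltW ct)) (le_trans (ltW td)).
Qed.

Lemma lim_herm_left c d : t0 <= c -> c < d -> d <= t1 -> jump_free C c d ->
  herm (left_lim P d).
Proof.
move=> t0c cd dt1 jf; have [_ cP _] := pwC1_primitive hP t0c cd dt1 jf.
apply: (herm_lim cP); apply: filterS (near_left_oo cd) => t /andP[ct td].
by apply: (pwC1_herm hP); rewrite (le_trans t0c (ltW ct)) (le_trans (ltW td)).
Qed.

Section Piece.
Context (c d : R) (t0c : t0 <= c) (cd : c < d) (dt1 : d <= t1) (jf : jump_free C c d).
Context (X : R -> 'M[R[i]]_(n + m)) (Y : R -> 'M[R[i]]_n).
Context (hX : forall t, c < t < d -> herm (X t)).
Context (XY : forall t, c < t < d -> state_block X t = Y t).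
Context (pY : forall k, primitive c d (fun t => cr k (Y t)) (fun t => cr k (F S t (X t)))).

(** The derivative of the pairing of P with the state, by the product rule. *)
Definition energy_rate t : R :=
  inner (mx_deriv P t) (Y t) + inner (with_ends P c d t) (F S t (X t)).

Lemma energy_primitive :
  primitive c d (fun t => inner (with_ends P c d t) (Y t)) energy_rate.
Proof.
have [_ _ pP] := pwC1_primitive hP t0c cd dt1 jf.
apply: primitive_eq (primitive_sum (fun k => primitiveM (ltW cd) (pP k) (pY k))).
- by move=> t _; rewrite innerE.
- by move=> t _; rewrite /energy_rate !innerE -big_split.
- exact: ltW.
Qed.

Lemma inner_CZ t : c < t < d ->
  inner (CZ C P t) (X t) = energy_rate t + inner (Z C t) (X t).
Proof.
move=> tcd; have /andP[ct td] := tcd.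
have t0t : t0 <= t by rewrite (le_trans t0c (ltW ct)).
rewrite /CZ 2!innerDl /energy_rate; congr (_ + _ + _).
  by rewrite inner_Emx -XY.
rewrite with_ends_in//; have [_ adj] := @F_adjoint _ _ _ S t t0t.
rewrite adj//; last exact: hX.
by apply: (pwC1_herm hP); rewrite t0t (le_trans (ltW td)).
Qed.

(** Integrating the product rule, in which the adjoint turns <P, F(t, X)> into
<F^* (t, P), X>. Integrability of the cost density and of the remainder are
equivalent, as their difference is the energy rate. *)
Lemma energy_identity : L1 c d (fun t => inner (Z C t) (X t)) ->
  L1 c d (fun t => inner (CZ C P t) (X t)) /\
  integ c d (fun t => inner (CZ C P t) (X t)) =
  integ c d (fun t => inner (Z C t) (X t))
  + inner (left_lim P d) (Y d) - inner (right_lim P c) (Y c).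
Proof.
move=> Z1; have pG := energy_primitive; have [G1 _] := pG.
have [L ->] := L1_oo (ltW cd) (fun t tcd => esym (inner_CZ tcd)) (L1D G1 Z1).
split=> //; rewrite integD// -(primitive_incr pG (lexx c) (ltW cd) (lexx d)).
by rewrite with_ends_l with_ends_r//; ring.
Qed.

End Piece.

Section Trajectory.
Context (X10 : 'M[R[i]]_n) (X : R -> 'M[R[i]]_(n + m)) (tX : trajectory C X10 X).

Let g k t := cr k (F S t (X t)).

Let g1 k : L1 t0 t1 (g k).
Proof. by have /mx_integrableP := traj_integrable tX; exact. Qed.

Lemma traj_primitive a b k : t0 <= a -> a <= b -> b <= t1 ->
  (forall k, (k < NT C)%N -> ~ (a <= tj k <= b)) ->
  primitive a b (fun t => cr k (state_block X t)) (g k).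
Proof.
move=> t0a ab bt1 nj; split; first exact: L1_sub (g1 k).
move=> t /andP[at_ tb]; rewrite (traj_flow tX t0a at_ (le_trans tb bt1)).
  by rewrite crD cr_op.
by move=> j /nj H /andP[h1 h2]; apply: H; rewrite h1 (le_trans h2).
Qed.

(** The integral equation is known on the closed intervals inside ]c, d[; letting
the left end tend to c extends it to the closed piece, with the one-sided limits
as boundary values. *)
Lemma traj_piece c d Yl Yr : t0 <= c -> c < d -> d <= t1 -> jump_free C c d ->
  mx_cvg c^'+ (state_block X) Yl -> mx_cvg d^'- (state_block X) Yr ->
  exists Y : R -> 'M[R[i]]_n, [/\ Y c = Yl, Y d = Yr,
    forall t, c < t < d -> state_block X t = Y t &
    forall k, primitive c d (fun t => cr k (Y t)) (g k)].
Proof.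
move=> t0c cd dt1 jf /mx_cvgP cl /mx_cvgP cr_.
have g1' k : L1 c d (g k) by exact: L1_sub (g1 k).
pose Y t := Yl + mx_int c t (fun t => F S t (X t)).
have Yk k t : cr k (Y t) = cr k Yl + integ c t (g k) by rewrite crD cr_op.
have Yc : Y c = Yl by apply: cr_inj => k; rewrite Yk integ_pt addr0.
have pY k : primitive c d (fun t => cr k (Y t)) (g k).
  by split=> // t _; rewrite Yc Yk.
have YX t : c < t < d -> state_block X t = Y t.
  move=> /andP[ct td]; apply: cr_inj => k.
  apply/eqP; rewrite -subr_eq0; apply/eqP.
  apply: (@cvg_unique _ _ (cr k (state_block X a) - cr k (Y a) @[a --> c^'+])) => //.
    apply: (@cvg_trans _ (cst (cr k (state_block X t) - cr k (Y t)) @ c^'+)); last exact: cvg_cst.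
    apply: near_eq_cvg; apply: filterS (near_right_oo ct) => a /andP[ca at_].
    have nj j : (j < NT C)%N -> ~ (a <= tj j <= t).
      by move=> /jf H /andP[h1 h2]; apply: H; rewrite (lt_le_trans ca) ?(le_lt_trans h2).
    have pX := traj_primitive k (le_trans t0c (ltW ca)) (ltW at_) (le_trans (ltW td) dt1) nj.
    have e1 := primitive_incr pX (lexx a) (ltW at_) (lexx t).
    have e2 := primitive_incr (pY k) (ltW ca) (ltW at_) (ltW td).
    by apply: subr_swap; rewrite e1 e2.
  rewrite -(subrr (cr k Yl)); apply: cvgB; first exact: cl.
  by rewrite -Yc; exact: primitive_cvg_right (pY k).
exists Y; split=> //; apply: cr_inj => k.
apply: (@cvg_unique _ _ (cr k (Y t) @[t --> d^'-])) => //.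
  exact: primitive_cvg_left (pY k).
apply: cvg_trans (cr_ k); apply: near_eq_cvg.
by apply: filterS (near_left_oo cd) => t tcd; rewrite YX.
Qed.

(** The NT jump times cut the horizon into pieces 0, ..., NT: piece k ends at
tj k for k < NT, and at t1 for k = NT. The states are the limits of the state
block from inside the piece. *)
Definition piece_start k := if k is j.+1 then tj j else t0.
Definition piece_end k := if (k < NT C)%N then tj k else t1.
Definition state_start k := if k is j.+1 then J S j (left_lim X (tj j)) else X10.
Definition state_end k :=
  if (k < NT C)%N then E *m left_lim X (tj k) *m E^t* else state_block X t1.

Lemma tj_le i j : (i <= j)%N -> tj i <= tj j.
Proof.
move=> /subnK <-; elim: (j - i)%N => [|k IH]; first by rewrite add0n.
by rewrite addSn (le_trans IH)// ltW// jump_time_incr.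
Qed.

Lemma tj_gt_t0 k : t0 < tj k.
Proof. exact: lt_le_trans (t0_lt_jump_time S) (tj_le (leq0n k)). Qed.

Lemma tj_lt_t1 k : (k < NT C)%N -> tj k < t1.
Proof. by rewrite NTP. Qed.

Lemma piece_start_ge k : t0 <= piece_start k.
Proof. by case: k => //= k; rewrite ltW// tj_gt_t0. Qed.

Lemma piece_end_le k : piece_end k <= t1.
Proof. by rewrite /piece_end; case: ifP => // /tj_lt_t1/ltW. Qed.

Lemma piece_lt k : (k <= NT C)%N -> piece_start k < piece_end k.
Proof.
rewrite /piece_end; case: k => [_|k kN] /=.
  by case: ifP => _; [exact: tj_gt_t0|rewrite ltrDl].
by case: ifP => _; [exact: jump_time_incr|exact: tj_lt_t1].
Qed.

Lemma piece_jump_free k : (k <= NT C)%N -> jump_free C (piece_start k) (piece_end k).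
Proof.
move=> kN j jN /andP[h1 h2].
have jk : (k <= j)%N.
  case: k h1 {kN h2} => // k h1; rewrite ltnNge; apply/negP => jk.
  by move: (lt_le_trans h1 (tj_le jk)); rewrite ltxx.
move: h2; rewrite /piece_end; case: ifPn => [_ h2|].
  by move: (lt_le_trans h2 (tj_le jk)); rewrite ltxx.
by rewrite -leqNgt => Nk; move: (leq_ltn_trans (leq_trans Nk jk) jN); rewrite ltnn.
Qed.

Lemma state_start_cvg k : (k <= NT C)%N ->
  mx_cvg (piece_start k)^'+ (state_block X) (state_start k).
Proof.
case: k => [_|k kN] /=; last exact: (traj_jump tX).
have lt0 := piece_lt (leq0n _); pose b := (t0 + piece_end 0) / 2.
have [b1 b2] := midf_lt lt0.
apply/mx_cvgP => k; rewrite -(traj_init tX).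
apply: (@primitive_cvg_right _ _ b _ (g k)) => //.
apply: traj_primitive => //; first exact: ltW.
  exact: le_trans (ltW b2) (piece_end_le 0).
move=> j jN /andP[_ h2].
apply: (@piece_jump_free 0%N (leq0n _) j jN).
by rewrite tj_gt_t0 (le_lt_trans h2).
Qed.

Lemma state_end_cvg k : (k <= NT C)%N ->
  mx_cvg (piece_end k)^'- (state_block X) (state_end k).
Proof.
move=> kN; have ltk := piece_lt kN; have jfk := piece_jump_free kN.
rewrite /piece_end /state_end; case: ifPn => kN'.
  apply: mx_cvgM; last exact: mx_cvg_cst.
  by apply: mx_cvgM; [exact: mx_cvg_cst|exact: traj_left_lim tX _ kN'].
move: ltk jfk; rewrite /piece_end (negbTE kN') => ltk jfk.
have [b1 b2] := midf_lt ltk.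
apply/mx_cvgP => l.
apply: (@primitive_cvg_left _ ((piece_start k + t1) / 2) _ _ (g l)) => //.
apply: traj_primitive => //; last 2 first.
- exact: ltW.
- move=> j jN /andP[h1 _]; apply: (jfk j jN).
  by rewrite (lt_le_trans b1)// tj_lt_t1.
exact: le_trans (piece_start_ge k) (ltW b1).
Qed.

Lemma left_lim_psd k : (k < NT C)%N -> psd (left_lim X (tj k)).
Proof.
move=> kN; apply: (psd_lim (traj_left_lim tX kN)).
apply: filterS (near_left_oo (tj_gt_t0 k)) => t /andP[h1 h2].
by apply: (traj_psd tX); rewrite ltW//= ltW// (lt_trans h2)// tj_lt_t1.
Qed.

Lemma not_jump_t0 k : (k < NT C)%N -> t0 <> tj k.
Proof. by move=> _ h; have := tj_gt_t0 k; rewrite -h ltxx. Qed.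

Lemma not_jump_t1 k : (k < NT C)%N -> t1 <> tj k.
Proof. by move=> /tj_lt_t1 + h; rewrite -h ltxx. Qed.

Let zx t := inner (Z C t) (X t).
Let cx t := inner (CZ C P t) (X t).

Lemma traj_piece_energy k : (k <= NT C)%N ->
  L1 (piece_start k) (piece_end k) zx ->
  L1 (piece_start k) (piece_end k) cx /\
  integ (piece_start k) (piece_end k) cx =
  integ (piece_start k) (piece_end k) zx
  + inner (left_lim P (piece_end k)) (state_end k)
  - inner (right_lim P (piece_start k)) (state_start k).
Proof.
move=> kN; have s0 := piece_start_ge k; have e1 := piece_end_le k.
have se := piece_lt kN; have jf := piece_jump_free kN.
have [Y [<- <- XY pY]] :=
  traj_piece s0 se e1 jf (state_start_cvg kN) (state_end_cvg kN).
apply: energy_identity => // t /andP[st te].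
have [] // : psd (X t).
by apply: (traj_psd tX); rewrite (le_trans s0 (ltW st)) (le_trans (ltW te)).
Qed.

(** The jump analogue of [inner_CZ]: the adjoint turns the state after the jump
into a pairing with the state before it. *)
Lemma inner_DZ k : (k < NT C)%N -> inner (DZ C P k) (left_lim X (tj k)) =
  inner (right_lim P (tj k)) (J S k (left_lim X (tj k)))
  - inner (left_lim P (tj k)) (E *m left_lim X (tj k) *m E^t*)
  + inner (Zj C k) (left_lim X (tj k)).
Proof.
move=> kN; rewrite /DZ innerDl innerBl inner_Emx; congr (_ - _ + _).
have [_ adj] := @J_adjoint _ _ _ S k.
rewrite adj//; last by have [] := left_lim_psd kN.
apply: (@lim_herm_right _ (piece_end k.+1)).
- exact: (piece_start_ge k.+1).
- exact: (piece_lt kN).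
- exact: piece_end_le.
- exact: (piece_jump_free kN).
Qed.

(** The identity on [t0, start of piece k], with the pairing taken just after
that time. Passing from k to k + 1 adds the piece k and the jump at its end, and
the pairings at tj k cancel against [inner_DZ]. *)
Lemma energy_chain k : (k <= NT C)%N -> L1 t0 t1 zx ->
  L1 t0 (piece_start k) cx /\
  integ t0 (piece_start k) zx + \sum_(j < k) inner (Zj C j) (left_lim X (tj j))
  + inner (right_lim P (piece_start k)) (state_start k) =
  inner (P t0) X10 + integ t0 (piece_start k) cx
  + \sum_(j < k) inner (DZ C P j) (left_lim X (tj j)).
Proof.
move=> + zx1; elim: k => [_|k IH kN].
  rewrite !big_ord0 /= !integ_pt; split.
    have [|//] := @L1_oo _ t0 t0 (cst 0) cx (lexx _) _ (L1_cst _ _ _).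
    by move=> t /andP[h1 h2]; have := lt_trans h1 h2; rewrite ltxx.
  rewrite (right_limE (pwC1_right hP _ not_jump_t0)) ?lexx ?ltrDl//; ring.
have [cx1 IHk] := IH (ltnW kN).
have pe : piece_end k = tj k by rewrite /piece_end kN.
have [] := @traj_piece_energy k (ltnW kN).
  by apply: L1_sub zx1; [exact: piece_start_ge|exact: piece_end_le].
rewrite pe => cx2 e2.
have sk := piece_start_ge k.
have kj : piece_start k <= tj k by rewrite -pe ltW// piece_lt// ltnW.
have cx3 := L1_glue sk kj cx1 cx2; split=> //=.
rewrite !big_ord_recr/= (integ_split sk kj); last first.
  by apply: L1_sub zx1 => //; rewrite ltW// tj_lt_t1.
rewrite (integ_split sk kj cx3) e2 inner_DZ// /state_end kN.
exact: energy_step.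
Qed.

Lemma energy_total : L1 t0 t1 zx ->
  L1 t0 t1 cx /\
  integ t0 t1 zx + (\sum_(j < NT C) inner (Zj C j) (left_lim X (tj j))
    + inner (ZT C) (state_block X t1)) =
  inner (P t0) X10 + integ t0 t1 cx
  + \sum_(j < NT C) inner (DZ C P j) (left_lim X (tj j))
  + inner (ZT C - P t1) (state_block X t1).
Proof.
move=> zx1; have [cx1 ch] := energy_chain (leqnn _) zx1.
have pe : piece_end (NT C) = t1 by rewrite /piece_end ltnn.
have [] := @traj_piece_energy (NT C) (leqnn _).
  by apply: L1_sub zx1; [exact: piece_start_ge|exact: piece_end_le].
rewrite pe => cx2 e2.
have sk := piece_start_ge (NT C).
have kj : piece_start (NT C) <= t1 by rewrite -pe ltW// piece_lt.
have cx3 := L1_glue sk kj cx1 cx2; split=> //=.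
rewrite (integ_split sk kj zx1) (integ_split sk kj cx3) e2 /state_end ltnn.
rewrite (left_limE (pwC1_left hP _ not_jump_t1)) ?lexx ?ltrDl ?hT// innerBl.
exact: energy_last_step.
Qed.

Lemma traj_Z_ge0 t : t0 <= t <= t1 -> 0 <= zx t.
Proof. by move=> tt; apply: inner_psd_ge0; [exact: Z_psd|exact: (traj_psd tX)]. Qed.

Lemma traj_Z_measurable : measurable_fun `[t0, t1] zx.
Proof.
have /mx_integrableP Z1 := Z_integrable C.
have /mx_measurableP mX := traj_measurable tX.
rewrite /zx (_ : (fun t => _) = fun t => \sum_k cr k (Z C t) * cr k (X t)).
  by apply: measurable_sum => k; apply: measurable_funM; [exact: L1_measurable|].
by apply/funext => t; rewrite innerE.
Qed.

Lemma cost_fin : L1 t0 t1 zx -> cost C X =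
  (integ t0 t1 zx + (\sum_(j < NT C) inner (Zj C j) (left_lim X (tj j))
    + inner (ZT C) (state_block X t1)))%:E.
Proof.
move=> zx1; rewrite /cost [RHS]EFinD; congr (_ + _)%E.
by rewrite /integ /Rintegral fineK//; apply: integrable_fin_num.
Qed.

(** The cost density is nonnegative, so it either is integrable or has an
infinite integral; in the second case every lower bound holds. *)
Lemma cost_infty : ~ L1 t0 t1 zx -> cost C X = +oo%E.
Proof.
move=> nzx; rewrite /cost; set I := (\int[_]_(_ in _) _)%E.
suff -> : I = +oo%E by rewrite addye.
apply: contrapT => /eqP nI; apply: nzx; apply/integrableP; split.
  apply/measurable_EFinP; exact: traj_Z_measurable.
rewrite [X in (X < _)%E](_ : _ = I); first by rewrite ltey.
apply: eq_integral => t; rewrite inE/= in_itv/= => tt.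
by rewrite ger0_norm// traj_Z_ge0.
Qed.

Lemma weak_duality : dual_feasible C P -> ((inner (P t0) X10)%:E <= cost C X)%E.
Proof.
move=> dP; have [zx1|/cost_infty ->] := pselect (L1 t0 t1 zx); last exact: leey.
have [cx1 tot] := energy_total zx1.
rewrite cost_fin// lee_fin tot -!addrA lerDl; apply: addr_ge0.
  apply: ae_integ_ge0 => //.
  move: (dual_flow dP); apply: ae_sub => t h tt.
  apply: inner_psd_ge0; first exact: h.
  by apply: (traj_psd tX); move: tt; rewrite /= in_itv.
apply: addr_ge0.
  apply: sumr_ge0 => j _; apply: inner_psd_ge0; first exact: (dual_jump dP).
  exact: left_lim_psd.
apply: inner_psd_ge0; first exact: (dual_final dP).
have -> : state_block X t1 = E *m X t1 *m E^t* by [].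
by apply: psd_congr; apply: (traj_psd tX); rewrite lexx lerDl ltW.
Qed.

End Trajectory.

End Energy.

(** * Near-optimal controls between jumps *)
Lemma ae_and {R : realType} (P Q : set R) :
  {ae @lebesgue_measure R, forall t, P t} -> {ae @lebesgue_measure R, forall t, Q t} ->
  {ae @lebesgue_measure R, forall t, P t /\ Q t}.
Proof.
by move=> hP hQ; apply: (@filterI _ (almost_everywhere (@lebesgue_measure R)) _ P Q).
Qed.

Section SwitchedGain.
Context {R : realType}.
Implicit Types (c s d : R).

Lemma L2_switch c s d (f : R -> R) (a : R) : L2 c d f ->
  L2 c d (fun t => if t < s then f t else a).
Proof.
move=> fL.
have mi (b : bool) : measurable_fun `[c, d] (fun t : R => (b (+) (t < s))%:R : R).
  have m0 : measurable_fun `[c, d] (\1_`]-oo, s[%classic : R -> R).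
    exact: measurable_indic.
  have -> : (fun t : R => (b (+) (t < s))%:R : R) =
      fun t => if b then 1 - \1_`]-oo, s[%classic t else \1_`]-oo, s[%classic t.
    apply/funext => t; rewrite indicE.
    have -> : (t \in `]-oo, s[%classic) = (t < s).
      by apply/idP/idP; rewrite inE/= in_itv.
    by case: b; case: (t < s); rewrite /= ?subrr ?subr0.
  by case: b => //; apply: measurable_funB => //; exact: measurable_cst.
have bi (b : bool) t : c <= t <= d -> `|(b (+) (t < s))%:R : R| <= 1.
  by move=> _; rewrite normr_nat lern1 leq_b1.
apply: (@L2_eq _ _ _ (fun t => (false (+) (t < s))%:R * f t + (true (+) (t < s))%:R * a)).
  by move=> t _; case: (t < s) => /=; rewrite ?mul1r ?mul0r ?addr0 ?add0r.
apply: L2D; first exact: L2M_bounded (mi _) (bi _) fL.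
exact: L2M_bounded (mi _) (bi _) (L2_cst _ _ _).
Qed.

Lemma mx_sq_integrable_switch c s d p q (K : R -> 'M[R[i]]_(p, q)) (K1 : 'M[R[i]]_(p, q)) :
  mx_sq_integrable `[c, d] K ->
  mx_sq_integrable `[c, d] (fun t => if t < s then K t else K1).
Proof.
move=> /mx_sq_integrableP KL; apply/mx_sq_integrableP => k.
apply: L2_eq (L2_switch s (cr k K1) (KL k)) => t _.
by case: ifP.
Qed.

End SwitchedGain.

Lemma inner_sumr {R : realType} p (A : 'M[R[i]]_p) (I : finType) (a : I -> R)
    (B : I -> 'M[R[i]]_p) :
  inner A (\sum_i (a i)%:C *: B i) = \sum_i a i * inner A (B i).
Proof.
rewrite innerE; under eq_bigr do rewrite cr_sum mulr_sumr.
rewrite exchange_big/=; apply: eq_bigr => i _; rewrite innerE mulr_sumr.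
by apply: eq_bigr => k _; rewrite crZ mulrCA.
Qed.

Section NearOptimalPiece.
Context {R : realType} (n m : nat) (S : impulsive_system R n m) (T : R)
  (hT : 0 < T) (C : horizon_cost S T) (P : R -> 'M[R[i]]_n) (hG : IGRE_solution C P).
Local Notation mu := (@lebesgue_measure R).
Local Notation E := (@Emx R n m).
Local Notation t0 := (t0 S).
Local Notation t1 := (t0 + T).
Local Notation tj := (jump_time S).
Context (hK : mx_sq_integrable `[t0, t1] (feedback_gain C P)).

Let hP := igre_pwC1 hG.

Lemma herm_Emx (Q : 'M[R[i]]_n) : herm Q -> herm (E^t* *m Q *m E).
Proof. by move=> hQ; have := herm_congr (E^t*) hQ; rewrite trmxCK. Qed.

Lemma CZ_herm : {ae mu, forall t, `[t0, t1]%classic t -> herm (CZ C P t)}.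
Proof.
move: (pwC1_deriv_herm hP); apply: ae_sub => t h tt; have := tt.
rewrite /= in_itv/= => tt'; have /andP[t0t _] := tt'.
rewrite /CZ; apply: hermD; last by have [] := @Z_psd _ _ _ _ _ C t tt'.
apply: hermD; first by apply: herm_Emx; exact: h.
have [hF _] := @F_adjoint _ _ _ S t t0t; apply: hF.
exact: (pwC1_herm hP).
Qed.

Lemma CZ_psd : {ae mu, forall t, `[t0, t1]%classic t -> psd (CZ C P t)}.
Proof.
have h := ae_and CZ_herm (igre_flow hG).
move: h; apply: ae_sub => t [h1 h2] tt.
by apply: GRE_psd; [exact: h1|exact: h2].
Qed.

(** The exceptional null set must not depend on Y: the closed-loop state is
substituted for it afterwards. *)
Lemma CZ_feedback : {ae mu, forall t, `[t0, t1]%classic t ->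
  forall Y, inner (CZ C P t) (completion Y (feedback_gain C P t) 0) = 0}.
Proof.
have h := ae_and CZ_herm (igre_flow hG).
move: h; apply: ae_sub => t [h1 h2] tt Y.
by apply: (GRE_inner (h1 tt) (h2 tt)).
Qed.

Section OnPiece.
Context (c d : R) (t0c : t0 <= c) (cd : c < d) (dt1 : d <= t1) (jf : jump_free C c d).

Let Z1 k : L1 c d (fun t => cr k (Z C t)).
Proof.
by have /mx_integrableP/(_ k) := Z_integrable C; exact: L1_sub.
Qed.

(** The derivative of P is integrable on a piece and the other terms are products
of bounded functions with integrable ones. For a constant gain this bounds the
flow remainder over a window. *)
Lemma CZ_inner_L1 (A : 'M[R[i]]_(n + m)) : herm A ->
  L1 c d (fun t => inner (CZ C P t) A).
Proof.
move=> hA; have [_ _ pP] := pwC1_primitive hP t0c cd dt1 jf.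
have /mx_integrableP FA : mx_integrable `[c, d] (fun t => F S t A).
  apply: F_integrable => //; first exact: ltW.
  by apply/mx_integrableP => k; exact: L1_cst.
pose f t := (\sum_k cr k (E *m A *m E^t*) * cr k (mx_deriv P t)
  + \sum_k cr k (with_ends P c d t) * cr k (F S t A)) + \sum_k cr k A * cr k (Z C t).
have f1 : L1 c d f.
  apply: L1D; last by apply: L1_sum => k; exact: L1Z.
  apply: L1D; apply: L1_sum => k; first by apply: L1Z; have [] := pP k.
  apply: L1M_bounded (FA k); first exact: primitive_measurable (ltW cd) (pP k).
  by move=> t; exact: primitive_bounded (pP k).
suff fE t : c < t < d -> f t = inner (CZ C P t) A by have [] := L1_oo (ltW cd) fE f1.
move=> tcd; have /andP[ct td] := tcd.
have t0t : t0 <= t by exact: le_trans (ltW ct).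
rewrite /CZ 2!innerDl inner_Emx (innerC (mx_deriv P t)) (innerC (Z C t)).
have [_ adj] := @F_adjoint _ _ _ S t t0t.
rewrite -adj//; last first.
  by apply: (pwC1_herm hP); rewrite t0t (le_trans (ltW td)).
by rewrite /f with_ends_in// !innerE.
Qed.

(** The trajectory follows the feedback up to a time s and the constant gain Kj
afterwards, so it has the left limit at d that the jump asks for, and only the
window [s, d] contributes to the remainder. The bound B on the state holds for
all s at once because kap dominates the coefficients of both gains; so s can be
chosen after B. *)
Lemma near_optimal_piece (Kj : 'M[R[i]]_(m, n)) (Y0 : 'M[R[i]]_n) (e : R) :
  psd Y0 -> 0 < e ->
  exists X : R -> 'M[R[i]]_(n + m),
  [/\ forall t, c <= t <= d -> psd (X t),
      mx_measurable `[c, d] X,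
      (forall k, primitive c d (fun t => cr k (state_block X t))
                               (fun t => cr k (F S t (X t)))) /\ state_block X c = Y0,
      mx_cvg d^'- X (completion (state_block X d) Kj 0) &
      L1 c d (fun t => inner (CZ C P t) (X t)) /\
      L1 c d (fun t => inner (Z C t) (X t)) /\
      integ c d (fun t => inner (CZ C P t) (X t)) <= e].
Proof.
move=> pY0 e0; pose K0 := feedback_gain C P.
have K0L : mx_sq_integrable `[c, d] K0.
  apply/mx_sq_integrableP => k; move/mx_sq_integrableP : hK => /(_ k).
  exact: L2_sub.
have KjL : mx_sq_integrable `[c, d] (fun=> Kj).
  by apply/mx_sq_integrableP => k; exact: L2_cst.
pose co := @closed_loop_coef R n m S.
(* dominates the coefficients under either gain, hence under every switch *)
pose kap t := \sum_k \sum_l (`|co K0 k l t| + `|co (fun=> Kj) k l t|).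
have kap1 : L1 c d kap.
  apply: L1_sum => k; apply: L1_sum => l.
  by apply: L1D; apply: L1_norm; apply: closed_loop_coef_L1 => //; exact: ltW.
have kap0 t : c <= t <= d -> 0 <= kap t.
  by move=> _; apply: sumr_ge0 => k _; apply: sumr_ge0 => l _; exact: addr_ge0.
pose B := (\sum_k `|cr k Y0|) * expR (integ c d kap).
have B0 : 0 <= B by apply: mulr_ge0; [exact: sumr_ge0|exact: expR_ge0].
pose wt t := \sum_l `|inner (CZ C P t) (completion (hbasis l) Kj 0)|.
have hbl1 l : L1 c d (fun t => inner (CZ C P t) (completion (hbasis l) Kj 0)).
  by apply: CZ_inner_L1; apply: herm_completion; exact: herm_hpart.
have wt1 : L1 c d wt by apply: L1_sum => l; exact: L1_norm.
(* over windows shorter than r, the remainder of a state bounded by B is below e;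
   B + 1 is a nonzero divisor *)
have [r r0 Hr] := integ_small wt1 (divr_gt0 e0 (ltr_wpDl B0 ltr01)).
pose s := Num.max c (d - r / 2).
have cs : c <= s by rewrite le_max lexx.
have sd : s < d by rewrite gt_max cd gtrBl divr_gt0.
have dsr : d - s < r.
  have h1 : d - r / 2 <= s by rewrite le_max lexx orbT.
  lra.
pose K t := if t < s then K0 t else Kj.
have KL : mx_sq_integrable `[c, d] K by exact: mx_sq_integrable_switch.
have Kkap k t : c <= t <= d -> \sum_l `|co K k l t| <= kap t.
  move=> _; rewrite /kap.
  apply: (@le_trans _ _ (\sum_l (`|co K0 k l t| + `|co (fun=> Kj) k l t|))); last first.
    rewrite [leRHS](bigD1 k)//= lerDl; apply: sumr_ge0 => k' _;
      apply: sumr_ge0 => l _; exact: addr_ge0.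
  apply: ler_sum => l _; rewrite {1}/co /closed_loop_coef /K.
  by case: ifP => _; [rewrite lerDl|rewrite lerDr].
have [Y [Yc pY Ybd psdY]] := closed_loop t0c (ltW cd) KL pY0 kap1 Kkap kap0.
pose X t := completion (Y t) (K t) 0.
have sX t : state_block X t = Y t by exact: Emx_completion.
have psdX t : c <= t <= d -> psd (X t) by move=> tcd; apply/psd_completion/psdY.
have mX : mx_measurable `[c, d] X.
  apply: completion_measurable; first by case: KL.
  by apply/mx_measurableP => k; have [] := Ybd k.
have hX t : c < t < d -> herm (X t).
  by move=> /andP[ct td]; have [] // : psd (X t); apply: psdX; rewrite !ltW.
have XY t : c < t < d -> state_block X t = Y t by [].
have [G1 _] := energy_primitive hP t0c cd dt1 jf pY.
have mZX : measurable_fun `[c, d] (fun t => inner (Z C t) (X t)).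
  rewrite (_ : (fun t => _) = fun t => \sum_k cr k (Z C t) * cr k (X t)); last first.
    by apply/funext => t; rewrite innerE.
  apply: measurable_sum => k; apply: measurable_funM.
    exact: (L1_measurable (Z1 k)).
  by move/mx_measurableP : mX; exact.
have cE := inner_CZ hP t0c dt1 hX XY.
pose cx t := inner (CZ C P t) (X t).
have mcx : measurable_fun `[c, d] cx.
  apply: (measurable_oo (ltW cd) (fun t tcd => esym (cE t tcd))).
  by apply: measurable_funD => //; exact: L1_measurable.
(* on [c, s[ the feedback is in force and the remainder vanishes a.e. *)
have cx0 : {ae mu, forall t, `[c, s]%classic t -> cst 0 t = cx t}.
  have nes : {ae mu, forall t, t != s}.
    exists [set s]; split => //; first exact: lebesgue_measure_set1.
    by move=> t /= /negP; rewrite negbK => /eqP.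
  have h2 := ae_and CZ_feedback nes.
  move: h2; apply: ae_sub => t [h1 ts]; rewrite /= in_itv/= => /andP[ct ts'].
  have lts : t < s by rewrite lt_neqAle ts.
  rewrite /cx /X /K lts h1//= in_itv/= (le_trans t0c ct) (le_trans ts')//.
  exact: le_trans (ltW sd) dt1.
have mcxs : measurable_fun `[c, s] cx.
  by apply: measurable_funS mcx => //; apply: subset_itvl; rewrite bnd_simp ltW.
have cx1l : L1 c s cx by apply: L1_ae cx0 (L1_cst _ _ _).
have cx0l : integ c s cx = 0.
  by rewrite -(ae_integ_eq (L1_cst c s 0) mcxs cx0) integ_cst// mul0r.
(* on [s, d] the remainder is linear in the coordinates of the state, which are
   bounded by B *)
pose f t := \sum_l cr l (Y t) * inner (CZ C P t) (completion (hbasis l) Kj 0).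
have fE t : s < t < d -> f t = cx t.
  move=> /andP[st td]; rewrite /cx /X /K ltNge (ltW st)/=.
  have hY : herm (Y t).
    by have [] // := psdY t; rewrite (le_trans cs (ltW st)) ltW.
  by rewrite -[in RHS](hpart_id hY) hpart_sum completion_sum inner_sumr.
have f1 : L1 s d f.
  apply: L1_sum => l; have [m1 m2] := Ybd l.
  by apply: (@L1_sub _ c d) => //; exact: L1M_bounded m1 m2 (hbl1 l).
have [cx1r cxr] := L1_oo (ltW sd) fE f1.
have fle : integ s d cx <= e.
  rewrite cxr; apply: le_trans (ler_norm _) _; apply: le_trans (integ_norm f1) _.
  apply: (@le_trans _ _ (integ s d (fun t => B * wt t))).
    apply: integ_le; [exact: L1_norm|by apply/L1Z/(L1_sub _ _ wt1)|].
    move=> t /andP[st td]; apply: le_trans (ler_norm_sum _ _ _) _.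
    rewrite mulr_sumr; apply: ler_sum => l _; rewrite normrM ler_wpM2r//.
    by have [_] := Ybd l; apply; rewrite td (le_trans cs).
  rewrite integZ; last exact: L1_sub wt1.
  have := Hr s d cs (ltW sd) (lexx d) dsr.
  rewrite (@integ_eq _ _ _ (fun t => `|wt t|) wt); last first.
    by move=> t _; rewrite ger0_norm// sumr_ge0.
  rewrite ltr_pdivlMr ?ltr_wpDl// => /ltW h1.
  have h2 : 0 <= integ s d wt by apply: integ_ge0 => t _; exact: sumr_ge0.
  by nra.
have cx1 := L1_glue cs (ltW sd) cx1l cx1r.
exists X; split => //.
- split; last by rewrite sX.
  by move=> k; apply: primitive_eq (pY k) => //; [move=> t _; rewrite sX|exact: ltW].
- rewrite sX; have cY : mx_cvg d^'- Y (Y d).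
    by apply/mx_cvgP => k; exact: primitive_cvg_left (pY k).
  apply: mx_cvg_near (cvg_completion Kj cY).
  apply: filterS (near_left_oo sd) => t /andP[st _].
  by rewrite /X /K ltNge (ltW st).
- split=> //; split; last by rewrite (integ_split cs (ltW sd) cx1) cx0l add0r.
  have zE t : c < t < d -> cx t - energy_rate S P c d X Y t = inner (Z C t) (X t).
    by move=> tcd; rewrite /cx cE//; ring.
  by have [] := L1_oo (ltW cd) zE (L1B cx1 G1).
Qed.

End OnPiece.

End NearOptimalPiece.

(** * Dual feasibility of a Riccati solution *)
Section DualFeasibility.
Context {R : realType} (n m : nat) (S : impulsive_system R n m) (T : R)
  (hT : 0 < T) (C : horizon_cost S T) (P : R -> 'M[R[i]]_n) (hG : IGRE_solution C P).
Local Notation E := (@Emx R n m).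
Local Notation t0 := (t0 S).
Local Notation t1 := (t0 + T).
Local Notation tj := (jump_time S).
Local Notation cstart := (piece_start S).
Local Notation cend := (piece_end C).
Context (hK : mx_sq_integrable `[t0, t1] (feedback_gain C P)).

Let hP := igre_pwC1 hG.

(** Start a near-optimal X at an arbitrary positive semidefinite Y0. The energy
identity says <P(c^+), Y0> = running cost + <P(d^-), E X(d) E^*> - remainder, and
the remainder is at most e. *)
Lemma IGRE_right_psd c d : t0 <= c -> c < d -> d <= t1 -> jump_free C c d ->
  psd (left_lim P d) -> psd (right_lim P c).
Proof.
move=> t0c cd dt1 jf pd; apply: psd_of_inner => [|Y0 pY0].
  exact: (lim_herm_right hP t0c cd).
apply/ler_addgt0Pl => e e0.
have [X [psdX _ [pX Xc] _ [cx1 [zx1 cxe]]]] :=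
  near_optimal_piece hG hK t0c cd dt1 jf 0 pY0 e0.
have hX t : c < t < d -> herm (X t).
  by move=> /andP[ct td]; have [] // : psd (X t); apply: psdX; rewrite !ltW.
have [_] := energy_identity hP t0c cd dt1 jf hX (fun t _ => erefl) pX zx1.
have zx0 : 0 <= integ c d (fun t => inner (Z C t) (X t)).
  apply: integ_ge0 => t /andP[ct td]; apply: inner_psd_ge0.
    by apply: Z_psd; rewrite (le_trans t0c) ?(le_trans td).
  by apply: psdX; rewrite ct.
have pYd : psd (state_block X d) by apply: psd_congr; apply: psdX; rewrite lexx ltW.
rewrite Xc => id; exact: (energy_lower_bound id zx0 (inner_psd_ge0 pd pYd) cxe).
Qed.

Lemma DZ_herm k : (k < NT C)%N -> herm (DZ C P k).
Proof.
move=> kN; rewrite /DZ; apply: hermD; last by have [] := Zj_psd kN.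
apply: hermD.
  have [h _] := @J_adjoint _ _ _ S k; apply: h.
  apply: (@lim_herm_right _ _ _ _ _ _ _ hP _ (cend k.+1)).
  - exact: (piece_start_ge S k.+1).
  - exact: (piece_lt hT kN).
  - exact: piece_end_le.
  - exact: (piece_jump_free kN).
apply/hermN/herm_Emx.
have h : cend k = tj k by rewrite /piece_end kN.
rewrite -h; apply: (@lim_herm_left _ _ _ _ _ _ _ hP (cstart k)).
- exact: piece_start_ge.
- exact: (piece_lt hT (ltnW kN)).
- exact: piece_end_le.
- exact: (piece_jump_free (ltnW kN)).
Qed.

(** For X the completion of Y by the gain of D_Z the remainder vanishes, so
<P(t_k^-), Y> = <P(t_k^+), J X> + <Z_k, X>, and J preserves the cone. *)
Lemma IGRE_left_psd k : (k < NT C)%N -> psd (right_lim P (tj k)) ->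
  psd (left_lim P (tj k)).
Proof.
move=> kN pr; have hD := DZ_herm kN; have gD := igre_jump hG kN.
have h : cend k = tj k by rewrite /piece_end kN.
apply: psd_of_inner => [|Y pY].
  rewrite -h; apply: (@lim_herm_left _ _ _ _ _ _ _ hP (cstart k)).
  - exact: piece_start_ge.
  - exact: (piece_lt hT (ltnW kN)).
  - exact: piece_end_le.
  - exact: (piece_jump_free (ltnW kN)).
pose X := completion Y (gain (DZ C P k)) 0.
have pX : psd X by exact: psd_completion.
have := GRE_inner hD gD Y; rewrite -/X /DZ innerDl innerBl inner_Emx.
have [_ adj] := @J_adjoint _ _ _ S k.
rewrite -adj; [|by case: pr|by case: pX].
rewrite Emx_completion.
have h1 := inner_psd_ge0 pr (@J_psd _ _ _ S k _ pX).
have h2 := inner_psd_ge0 (Zj_psd kN) pX.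
by move=> id; exact: (jump_lower_bound id h1 h2).
Qed.

(** Backward induction over the pieces, starting from P(t1) = Z_T. *)
Lemma IGRE_end_psd k : (k <= NT C)%N -> psd (left_lim P (cend k)).
Proof.
move=> kN; rewrite -(subKn kN); elim: (NT C - k)%N => [|j IH].
  rewrite subn0 /piece_end ltnn (left_limE (pwC1_left hP _ (@not_jump_t1 _ _ _ _ _ C))).
    by rewrite (igre_final hG); exact: ZT_psd.
  by rewrite lexx ltrDl hT.
have [Nj|jN] := leqP (NT C) j.
  have e0 : (NT C - j = 0)%N by apply/eqP; rewrite subn_eq0.
  have e1 : (NT C - j.+1 = 0)%N by apply/eqP; rewrite subn_eq0 ltnW.
  by rewrite e1; move: IH; rewrite e0.
have lt1 : (NT C - j.+1 < NT C)%N by rewrite ltn_subrL (leq_ltn_trans _ jN).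
have e1 : (NT C - j = (NT C - j.+1).+1)%N by rewrite subnS prednK// subn_gt0.
move: IH lt1; rewrite e1; move: (NT C - j.+1)%N => i IH iN.
have -> : cend i = tj i by rewrite /piece_end iN.
apply: (IGRE_left_psd iN).
apply: (IGRE_right_psd _ _ _ _ IH).
- exact: (piece_start_ge S i.+1).
- exact: (piece_lt hT iN).
- exact: piece_end_le.
- exact: (piece_jump_free iN).
Qed.

Lemma locate_piece t : t0 < t <= t1 ->
  exists2 k, (k <= NT C)%N & cstart k < t <= cend k.
Proof.
move=> /andP[t0t tt1].
have ex : exists k, (k == NT C) || (t <= tj k) by exists (NT C); rewrite eqxx.
case: (ex_minnP ex) => k kP kmin.
have kN : (k <= NT C)%N by apply: kmin; rewrite eqxx.
exists k => //; apply/andP; split.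
  case: k kP kmin kN => //= k _ kmin kN; rewrite ltNge; apply/negP => h.
  by have := kmin k; rewrite h orbT => /(_ isT); rewrite ltnn.
rewrite /piece_end; case: ifPn => // kN'.
by case/orP: kP => // /eqP kE; rewrite kE ltnn in kN'.
Qed.

(** Pieces are taken half-open, ]start, end], so that a jump time belongs to the
piece before the jump; this is why the inequality is strict. The time t0 gets
index 0. *)
Definition piece_index t : nat := (\sum_(j < NT C) nat_of_bool (tj j < t)%R)%N.

Lemma piece_indexE k t : (k <= NT C)%N -> cstart k < t <= cend k ->
  piece_index t = k.
Proof.
move=> kN /andP[kt tk]; rewrite /piece_index.
rewrite (eq_bigr (fun j : 'I_(NT C) => nat_of_bool (j < k)%N)).
  rewrite -big_mkcond/= -(big_ord_widen _ (fun=> 1%N) kN).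
  by rewrite sum1_card card_ord.
move=> j _; congr nat_of_bool; apply/idP/idP => [jt|jk].
  rewrite ltnNge; apply/negP => kj; move: tk; rewrite /piece_end.
  rewrite (leq_ltn_trans kj (ltn_ord j)) => h.
  by have := lt_le_trans jt (le_trans h (tj_le S kj)); rewrite ltxx.
case: k kN kt jk {tk} => // k kN kt jk; apply: le_lt_trans kt.
exact: tj_le.
Qed.

Lemma piece_index_t0 : piece_index t0 = 0%N.
Proof.
rewrite /piece_index big1// => j _; have := tj_gt_t0 S j.
by rewrite ltNge => h; rewrite ltNge ltW// tj_gt_t0.
Qed.

Lemma IGRE_dual_feasible : dual_feasible C P.
Proof.
split.
- exact: hP.
- move=> t tt nj; have /andP[t0t tt1] := tt.
  move: tt1; rewrite le_eqVlt => /predU1P[->|tt1].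
    by rewrite (igre_final hG); exact: ZT_psd.
  suff [d [td dt1 jf pd]] : exists d, [/\ t < d, d <= t1, jump_free C t d &
      psd (left_lim P d)].
    have t01 : t0 <= t < t1 by rewrite t0t.
    have <- := right_limE (pwC1_right hP t01 nj).
    exact: (IGRE_right_psd t0t td dt1 jf pd).
  move: t0t; rewrite le_eqVlt => /predU1P[<-|t0t].
    exists (cend 0); split.
    - exact: (piece_lt hT (leq0n (NT C))).
    - exact: piece_end_le.
    - exact: (piece_jump_free (leq0n (NT C))).
    - exact: (IGRE_end_psd (leq0n (NT C))).
  have [|k kN /andP[kt tk]] := @locate_piece t; first by rewrite t0t ltW.
  exists (cend k); split; [|exact: piece_end_le| |exact: (IGRE_end_psd kN)].
    rewrite lt_neqAle tk andbT; apply/eqP => h.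
    move: h; rewrite /piece_end; case: ifPn => [kN'|_] h; first exact: (nj k kN').
    by move: tt1; rewrite h ltxx.
  move=> j jN /andP[h1 h2]; apply: (piece_jump_free kN jN).
  by rewrite (lt_trans kt h1) h2.
- exact: (CZ_psd hG).
- by move=> k kN; apply: GRE_psd; [exact: DZ_herm|exact: (igre_jump hG)].
- by rewrite (igre_final hG) subrr; exact: psd0.
Qed.

End DualFeasibility.

(** * Near-optimal trajectories *)
Section Gluing.
Context {R : realType}.

Lemma measurable_glue (a b c : R) (f : R -> R) : a <= b -> b <= c ->
  measurable_fun `[a, b] f -> measurable_fun `[b, c] f -> measurable_fun `[a, c] f.
Proof.
move=> ab bc m1 m2.
have -> : `[a, c]%classic = `[a, b]%classic `|` `]b, c]%classic.
  by apply: itv_bndbnd_setU; rewrite bnd_simp.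
apply/measurable_funU => //; split=> //; apply: measurable_funS m2 => //.
by apply: subset_itvr; rewrite bnd_simp.
Qed.

Lemma L1_pt (a : R) (f : R -> R) : L1 a a f.
Proof.
suff fE t : a < t < a -> cst 0 t = f t by have [] := L1_oo (lexx a) fE (L1_cst _ _ _).
by move=> /andP[h1 h2]; have := lt_trans h1 h2; rewrite ltxx.
Qed.

End Gluing.

Section Assembly.
Context {R : realType} (n m : nat) (S : impulsive_system R n m) (T : R)
  (hT : 0 < T) (C : horizon_cost S T).
Local Notation E := (@Emx R n m).
Local Notation t0 := (t0 S).
Local Notation t1 := (t0 + T).
Local Notation tj := (jump_time S).
Local Notation cstart := (piece_start S).
Local Notation cend := (piece_end C).

(** Properties of intervals that are stable under concatenation, such as
integrability or an additive bound, pass from the pieces to the horizon. *)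
Lemma piece_chain (Q : R -> R -> Prop) : Q t0 t0 ->
  (forall a b c, a <= b -> b <= c -> Q a b -> Q b c -> Q a c) ->
  (forall k, (k <= NT C)%N -> Q (cstart k) (cend k)) -> Q t0 t1.
Proof.
move=> Q0 Qg Qk.
have chain k : (k <= NT C)%N -> Q t0 (cstart k).
  elim: k => [//|k IH kN].
  have := Qk k (ltnW kN); rewrite /piece_end kN => Qk1.
  apply: (Qg _ (cstart k)) (IH (ltnW kN)) Qk1; first exact: piece_start_ge.
  by have := piece_lt hT (ltnW kN); rewrite /piece_end kN => /ltW.
have := Qk _ (leqnn (NT C)); rewrite /piece_end ltnn => Ql.
apply: (Qg _ (cstart (NT C))) (chain _ (leqnn _)) Ql; first exact: piece_start_ge.
by have := piece_lt hT (leqnn (NT C)); rewrite /piece_end ltnn => /ltW.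
Qed.

Section GluePieces.
Context (X10 : 'M[R[i]]_n) (Xk : nat -> R -> 'M[R[i]]_(n + m))
  (XL : nat -> 'M[R[i]]_(n + m)).
Context (psdX : forall k t, (k <= NT C)%N -> cstart k <= t <= cend k -> psd (Xk k t)).
Context (mX : forall k, (k <= NT C)%N -> mx_measurable `[cstart k, cend k] (Xk k)).
Context (pX : forall k l, (k <= NT C)%N -> primitive (cstart k) (cend k)
  (fun t => cr l (state_block (Xk k) t)) (fun t => cr l (F S t (Xk k t)))).
Context (cX : forall k, (k < NT C)%N -> mx_cvg (tj k)^'- (Xk k) (XL k)).
Context (X0 : state_block (Xk 0) t0 = X10).
Context (XS : forall k, (k < NT C)%N -> state_block (Xk k.+1) (tj k) = J S k (XL k)).

Definition glued t := Xk (piece_index C t) t.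

Lemma glued_in k t : (k <= NT C)%N -> cstart k < t <= cend k -> glued t = Xk k t.
Proof. by move=> kN tk; rewrite /glued (piece_indexE kN tk). Qed.

Lemma glued_oo k t : (k <= NT C)%N -> cstart k < t < cend k -> Xk k t = glued t.
Proof. by move=> kN /andP[h1 h2]; rewrite (@glued_in k)// h1 ltW. Qed.

Lemma glued_t0 : glued t0 = Xk 0 t0.
Proof. by rewrite /glued piece_index_t0. Qed.

Lemma glued_left_lim k : (k < NT C)%N -> mx_cvg (tj k)^'- glued (XL k).
Proof.
move=> kN; apply: mx_cvg_near (cX kN).
have h := piece_lt hT (ltnW kN).
have e : cend k = tj k by rewrite /piece_end kN.
rewrite e in h; apply: filterS (near_left_oo h) => t tt.
by apply: glued_oo (ltnW kN) _; rewrite e.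
Qed.

(** An interval [a, b] without jump times lies in a single piece k, where a may
be the left end only if it is t0. So the flow equation is that of Xk k, and the
left limits and the jump conditions involve only adjacent pieces. *)
Lemma glued_trajectory : trajectory C X10 glued.
Proof.
split.
- move=> t /andP[t0t tt1]; move: t0t; rewrite le_eqVlt => /predU1P[<-|t0t].
    by rewrite glued_t0; apply: psdX => //=; rewrite lexx ltW// (piece_lt hT (leq0n _)).
  have [|k kN ktk] := @locate_piece _ _ _ _ _ C t; first by rewrite t0t.
  rewrite (glued_in kN ktk); apply: psdX => //.
  by case/andP: ktk => /ltW -> ->.
- apply/mx_measurableP => l; apply: (@piece_chain (fun a b => measurable_fun `[a, b] _)).
  + by rewrite set_itv1; exact: measurable_fun_set1.
  + by move=> a b c ab bc; exact: measurable_glue.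
  + move=> k kN; have /mx_measurableP/(_ l) := mX kN.
    apply: measurable_oo; first by rewrite ltW// piece_lt.
    by move=> t tk; rewrite (glued_oo kN tk).
- apply/mx_integrableP => l; apply: (@piece_chain (fun a b => L1 a b _)).
  + exact: L1_pt.
  + by move=> a b c ab bc; exact: L1_glue.
  + move=> k kN; have [h1 _] := pX l kN.
    have gE t : cstart k < t < cend k -> cr l (F S t (Xk k t)) = cr l (F S t (glued t)).
      by move=> tk; rewrite (glued_oo kN tk).
    by have [] := L1_oo (ltW (piece_lt hT kN)) gE h1.
- move=> a b t0a ab bt1 nj; apply: cr_inj => l; rewrite crD cr_op.
  move: (ab); rewrite le_eqVlt => /predU1P[<-|ltab].
    by rewrite -[X in _ + X]/(integ a a _) integ_pt addr0.
  have [|k kN /andP[kb bk]] := @locate_piece _ _ _ _ _ C b.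
    by rewrite bt1 andbT (le_lt_trans t0a).
  have ka : cstart k <= a.
    case: k kN kb {bk} => //= k kN kb; rewrite leNgt; apply/negP => ak.
    by apply: (nj k kN); rewrite (ltW ak) (ltW kb).
  have gE t : a <= t <= b -> state_block glued t = state_block (Xk k) t
       /\ (cstart k < t -> glued t = Xk k t).
    move=> /andP[at_ tb].
    have h : cstart k < t -> glued t = Xk k t.
      by move=> kt; apply: glued_in; rewrite // kt (le_trans tb).
    split=> //; rewrite /state_block.
    have : cstart k <= t by exact: le_trans at_.
    rewrite le_eqVlt => /predU1P[kt|/h ->//].
    case: k kN kb bk ka h kt => [|k] kN kb bk ka h /= kt; first by rewrite -kt glued_t0.
    by case: (nj k kN); rewrite kt at_ tb.
  have gE1 t : a <= t <= b -> state_block glued t = state_block (Xk k) t.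
    by move=> /gE[].
  rewrite gE1 ?ab ?lexx// (gE1 a) ?ab ?lexx//.
  have := primitive_incr (pX l kN) ka ab bk => /eqP; rewrite subr_eq addrC => /eqP ->.
  congr (_ + _).
  have FE t : a < t < b -> cr l (F S t (Xk k t)) = cr l (F S t (glued t)).
    move=> /andP[at_ tb]; have tab : a <= t <= b by rewrite !ltW.
    by have [_ ->//] := gE t tab; exact: le_lt_trans at_.
  have [pX1 _] := pX l kN.
  by have [_] := L1_oo ab FE (L1_sub ka bk pX1).
- by move=> k kN; have h := glued_left_lim kN; rewrite (left_limE h).
- move=> k kN; rewrite (left_limE (glued_left_lim kN)) -XS//.
  have h := piece_lt hT kN.
  apply/mx_cvgP => l; have := primitive_cvg_right h (pX l kN).
  apply: cvg_trans; apply: near_eq_cvg.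
  apply: filterS (near_right_oo h) => t tt.
  by rewrite /state_block (glued_oo kN tt).
- by rewrite /state_block glued_t0.
Qed.

End GluePieces.

Section NearOptimal.
Context (P : R -> 'M[R[i]]_n) (hG : IGRE_solution C P).
Context (hK : mx_sq_integrable `[t0, t1] (feedback_gain C P)).
Context (X10 : 'M[R[i]]_n) (pX10 : psd X10).

(** The pieces are built forwards, each from the state that the previous one
produces at the jump. A remainder of e / T per unit of time adds up to at most e,
and the jump remainders vanish because X(t_k^-) is a completion by the gain of
D_Z. *)
Lemma near_optimal_trajectory (e : R) : 0 < e -> exists2 X, trajectory C X10 X &
  (cost C X <= (inner (P t0) X10 + e)%:E)%E.
Proof.
move=> e0; have eT : 0 < e / T by exact: divr_gt0.
pose K k := gain (DZ C P k).
pose prop k Y0 (X : R -> 'M[R[i]]_(n + m)) :=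
  [/\ forall t, cstart k <= t <= cend k -> psd (X t),
      mx_measurable `[cstart k, cend k] X,
      (forall l, primitive (cstart k) (cend k) (fun t => cr l (state_block X t))
                               (fun t => cr l (F S t (X t)))) /\ state_block X (cstart k) = Y0,
      mx_cvg (cend k)^'- X (completion (state_block X (cend k)) (K k) 0) &
      L1 (cstart k) (cend k) (fun t => inner (CZ C P t) (X t)) /\
      L1 (cstart k) (cend k) (fun t => inner (Z C t) (X t)) /\
      integ (cstart k) (cend k) (fun t => inner (CZ C P t) (X t))
        <= e / T * (cend k - cstart k)].
(* choice needs a total function, so the start Y0 is arbitrary here and its
   positivity is a premise *)
have : forall kY : nat * 'M[R[i]]_n, exists X,
    (kY.1 <= NT C)%N -> psd kY.2 -> prop kY.1 kY.2 X.
  move=> [k Y0] /=.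
  have [[kN pY0]|h] := pselect ((k <= NT C)%N /\ psd Y0); last first.
    by exists (fun=> 0) => h1 h2; case: h.
  have [] := @near_optimal_piece _ _ _ _ _ _ _ hG hK _ _ (piece_start_ge S k)
    (piece_lt hT kN) (piece_end_le C k) (piece_jump_free kN) (K k) Y0
    (e / T * (cend k - cstart k)) pY0 _.
    by rewrite mulr_gt0// subr_gt0 piece_lt.
  by move=> X HX; exists X.
move=> /choice[G HG].
pose st := fix st k := if k is j.+1 then J S j (left_lim (G (j, st j)) (tj j)) else X10.
pose Xk k := G (k, st k).
pose XL k := completion (state_block (Xk k) (cend k)) (K k) 0.
have psd_end k X Y0 : (k <= NT C)%N -> prop k Y0 X -> psd (state_block X (cend k)).
  move=> kN [psdX _ _ _ _]; apply: psd_congr; apply: psdX.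
  by rewrite lexx andbT ltW// piece_lt.
have Hst k : (k <= NT C)%N -> psd (st k).
  elim: k => [//|k IH kN] /=; apply: J_psd.
  have Hk := HG (k, st k) (ltnW kN) (IH (ltnW kN)).
  have [_ _ _ cX _] := Hk; have ek : cend k = tj k by rewrite /piece_end kN.
  rewrite -ek (left_limE cX); apply: psd_completion.
  exact: (psd_end _ _ _ (ltnW kN) Hk).
have HX k : (k <= NT C)%N -> prop k (st k) (Xk k) by move=> kN; exact: (HG (k, st k) kN (Hst k kN)).
have cX k : (k < NT C)%N -> mx_cvg (tj k)^'- (Xk k) (XL k).
  by move=> kN; have [_ _ _ + _] := HX k (ltnW kN); rewrite {1}/piece_end kN.
pose X := glued Xk.
have tX : trajectory C X10 X.
  apply: (@glued_trajectory _ _ XL).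
  - by move=> k t kN; have [+ _ _ _ _] := HX k kN; exact.
  - by move=> k kN; have [_ + _ _ _] := HX k kN.
  - by move=> k l kN; have [_ _ [+ _] _ _] := HX k kN; exact.
  - exact: cX.
  - by have [_ _ [_ +] _ _] := HX 0%N (leq0n _).
  - by move=> k kN; have [_ _ [_ ->] _ _] := HX k.+1 kN; rewrite /= (left_limE (cX k kN)).
exists X => //.
have XE k t : (k <= NT C)%N -> cstart k < t < cend k -> Xk k t = X t.
  by move=> kN; exact: glued_oo.
have zx1 : L1 t0 t1 (fun t => inner (Z C t) (X t)).
  apply: (@piece_chain (fun a b => L1 a b _)).
  - exact: L1_pt.
  - by move=> a b c ab bc; exact: L1_glue.
  - move=> k kN; have [_ _ _ _ [_ [z1 _]]] := HX k kN.
    have gE t : cstart k < t < cend k -> inner (Z C t) (Xk k t) = inner (Z C t) (X t).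
      by move=> tk; rewrite (XE k).
    by have [] := L1_oo (ltW (piece_lt hT kN)) gE z1.
have [_ cxe] : L1 t0 t1 (fun t => inner (CZ C P t) (X t)) /\
    integ t0 t1 (fun t => inner (CZ C P t) (X t)) <= e / T * (t1 - t0).
  apply: (@piece_chain (fun a b => L1 a b _ /\ integ a b _ <= e / T * (b - a))).
  - by split; [exact: L1_pt|rewrite integ_pt subrr mulr0].
  - move=> a b c ab bc [l1 i1] [l2 i2]; have l3 := L1_glue ab bc l1 l2.
    by split=> //; rewrite (integ_split ab bc l3); lra.
  - move=> k kN; have [_ _ _ _ [c1 [_ ce]]] := HX k kN.
    have gE t : cstart k < t < cend k -> inner (CZ C P t) (Xk k t) = inner (CZ C P t) (X t).
      by move=> tk; rewrite (XE k).
    have [h1 h2] := L1_oo (ltW (piece_lt hT kN)) gE c1.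
    by split; [exact: h1|rewrite h2; exact: ce].
rewrite (cost_fin zx1).
have [_ ->] := energy_total hT (igre_pwC1 hG) tX zx1.
rewrite (igre_final hG) subrr inner0l addr0 big1 ?addr0.
  rewrite lee_fin lerD2l; apply: le_trans cxe _.
  by rewrite addrAC subrr add0r divfK// gt_eqF.
move=> [j jN] _ /=.
have -> : left_lim X (tj j) = XL j by apply: left_limE; apply: glued_left_lim.
by apply: GRE_inner; [exact: (DZ_herm hT hG)|exact: (igre_jump hG)].
Qed.

End NearOptimal.

End Assembly.

Theorem theorem3p8 (R : realType) (n m : nat) (hn : (0 < n)%N) (hm : (0 < m)%N)
    (S : impulsive_system R n m) (T : R) (hT : 0 < T) (C : horizon_cost S T)
    (X10 : 'M[R[i]]_n) (hX10 : psd X10) (Pstar : R -> 'M[R[i]]_n)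
    (hP : IGRE_solution C Pstar)
    (hK : mx_sq_integrable `[t0 S, t0 S + T] (feedback_gain C Pstar)) :
  [/\ optimal_cost C X10 = (inner (Pstar (t0 S)) X10)%:E,
      dual_feasible C Pstar
    & forall P : R -> 'M[R[i]]_n, dual_feasible C P ->
        inner (P (t0 S)) X10 <= inner (Pstar (t0 S)) X10].
Proof.
have dP := IGRE_dual_feasible hT hP hK.
have weak P : dual_feasible C P -> ((inner (P (t0 S)) X10)%:E <= optimal_cost C X10)%E.
  move=> dQ; apply: le_ereal_inf_tmp => _ [X tX <-].
  exact: (weak_duality hT (dual_pwC1 dQ) tX dQ).
have opt : optimal_cost C X10 = (inner (Pstar (t0 S)) X10)%:E.
  apply/eqP; rewrite eq_le weak// andbT; apply/lee_addgt0Pr => e e0.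
  have [X tX cX] := near_optimal_trajectory hT hP hK hX10 e0.
  by apply: le_trans cX; apply: ereal_inf_lbound; exists X.
by split=> // P dQ; rewrite -lee_fin -opt weak.
Qed.
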